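(* For every integer $n \geq 2$, every connected bisplit graph $G$ on $n$ vertices has the de Bruijn-Erd\H{o}s property; that is, the metric space $(V(G), d_G)$ has a universal line or has at least $n$ distinct lines.
   Context: A connected graph $G$ is bisplit if its vertex set can be partitioned into three stable (independent) sets $X$, $Y$, $Z$ (some possibly empty) such that every vertex of $Y$ is adjacent to every vertex of $Z$. The graph $G$ is viewed as a metric space with $d_G$ the usual shortest-path distance. In a metric space $(V,\rho)$, an element $b$ is between $a$ and $c$ if $\rho(a,b)+\rho(b,c)=\rho(a,c)$; three elements are collinear if one of them is between the other two. For distinct $a,b\in V$, the line generated by $a$ and $b$ is the set consisting of $a$, $b$, and all elements $c$ such that $a,b,c$ are collinear. A line is universal if it equals the whole ground set $V$. A graph on $n$ vertices has the de Bruijn-Erd\H{o}s property if its metric space has a universal line or at least $n$ distinct lines. *)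

(* Defs.v *)
From mathcomp Require Import all_boot.
Set Implicit Arguments. Unset Strict Implicit. Unset Printing Implicit Defensive.

Definition simple_graph (T : finType) (e : rel T) : Prop :=
  symmetric e /\ irreflexive e.

Fixpoint walk (T : finType) (e : rel T) (k : nat) (x y : T) : bool :=
  match k with
  | 0 => x == y
  | k'.+1 => [exists z, e x z && walk e k' z y]
  end.

Definition connected_graph (T : finType) (e : rel T) : Prop :=
  forall x y : T, connect e x y.

(* Shortest-path distance: least k with a walk of length k (any shortest
   path has fewer than #|T| edges; for connected graphs this is d_G). *)
Definition gdist (T : finType) (e : rel T) (x y : T) : nat :=
  \big[minn/#|T|]_(k < #|T| | walk e k x y) (k : nat).

Definition stable (T : finType) (e : rel T) (A : {set T}) : bool :=
  [forall x in A, forall y in A, ~~ e x y].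

Definition bisplit (T : finType) (e : rel T) : Prop :=
  exists X Y Z : {set T},
    [disjoint X & Y] /\ [disjoint X & Z] /\ [disjoint Y & Z] /\
    X :|: Y :|: Z = [set: T] /\
    stable e X /\ stable e Y /\ stable e Z /\
    (forall y z, y \in Y -> z \in Z -> e y z).

Definition between (T : finType) (e : rel T) (a b c : T) : bool :=
  gdist e a b + gdist e b c == gdist e a c.

Definition collinear (T : finType) (e : rel T) (a b c : T) : bool :=
  [|| between e a b c, between e b a c | between e a c b].

Definition line (T : finType) (e : rel T) (a b : T) : {set T} :=
  [set c | [|| c == a, c == b | collinear e a b c]].

Definition lines (T : finType) (e : rel T) : {set {set T}} :=
  [set line e ab.1 ab.2 | ab in [set ab : T * T | ab.1 != ab.2]].

Definition has_universal_line (T : finType) (e : rel T) : Prop :=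
  exists a b : T, a != b /\ line e a b = [set: T].

Definition deBruijn_Erdos (T : finType) (e : rel T) : Prop :=
  has_universal_line e \/ #|T| <= #|lines e|.

(* Main.v *)
(**
Let Y, Z be the two sides.  If one of them is empty, or if no vertex of X has
neighbours on both sides, some edge generates a universal line.  Otherwise all
distances are at most 4 and are determined by the kinds of the two vertices,
their adjacency, and whether they have a common neighbour, so every line can be
written down explicitly.  Call a vertex of X a pendant if its neighbours lie on
one side, and mid otherwise.

Assume there is no universal line.  The number of lines is bounded below by
adding up families of lines that are told apart by which kinds of vertices they
contain.  The main difficulty is to produce as many lines as there are pendants
on a side: for a mid b, the lines xb (x a pendant) can coincide only for pendants
with pairwise disjoint neighbourhoods, and in a class of at least three such
twins the lines xx' are pairwise distinct.  Two different mids, which exist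
because edges at pendants are not universal, recover the factor lost in classes
of size two.
*)

Require Import Defs.
From mathcomp Require Import all_boot zify.
Set Implicit Arguments. Unset Strict Implicit. Unset Printing Implicit Defensive.

(* [inl s] is a vertex of the side Y ([s = true]) or Z ([s = false]);
   [inr (Some s)] is a vertex of X with neighbours on side [s] only;
   [inr None] is a vertex of X with neighbours on both sides.
   Statements quantified over [s] cover the symmetry between Y and Z. *)
Notation kind := (bool + option bool)%type.

(** * Distances *)

Section Graph.
Context (T : finType) (e : rel T).

Lemma walkP k x y :
  reflect (exists p, [/\ path e x p, size p = k & last x p = y]) (walk e k x y).
Proof.
elim: k x => [|k IH] x /=.
  apply: (iffP eqP) => [<-|[[|z p] [] //]]; by exists [::].
apply: (iffP existsP) => [[z /andP[exz /IH[p [pp sp lp]]]]|[[|z p] [] //=]].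
  by exists (z :: p); rewrite /= exz pp sp lp.
move=> /andP[exz pp] [sp] lp; exists z; rewrite exz; apply/IH; by exists p.
Qed.

(** For [k >= #|T|] this holds because the minimum starts from the default [#|T|]. *)
Lemma gdist_le k x y : walk e k x y -> gdist e x y <= k.
Proof.
move=> w; have bd j : gdist e x y <= #|T|.
  rewrite /gdist; elim/big_rec: _ => // i m _ h; by rewrite geq_min h orbT.
case: (ltnP k #|T|) => [lt|]; last by apply: leq_trans; apply: bd 0.
have := mem_index_enum (Ordinal lt); rewrite /gdist; elim: (index_enum _) => //= i r IH.
rewrite big_cons inE => /predU1P[<-|/IH]; first by rewrite w geq_minl.
by case: ifP => // _ h; rewrite geq_min h orbT.
Qed.

Lemma gdist_eq k x y :
  walk e k x y -> (forall j, j < k -> ~~ walk e j x y) -> gdist e x y = k.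
Proof.
move=> w min; apply/eqP; rewrite eqn_leq gdist_le //=.
rewrite /gdist; elim/big_rec: _ => [|i m wi h]; last first.
  rewrite leq_min h andbT leqNgt; apply/negP => /min; by rewrite wi.
(* The default [#|T|] is not below [k]: otherwise shortening the walk to one without repetitions, of
   fewer than [#|T|] steps, would contradict minimality. *)
rewrite leqNgt; apply/negP => lt.
have /walkP[p [pp sp lp]] := w; move: lp.
case/shortenP: pp => q pq uq _ lq.
have : walk e (size q) x y by apply/walkP; exists q.
apply/negP/min; apply: leq_trans lt.
apply: leqW; have /= <- := card_uniqP uq; exact: max_card.
Qed.

Lemma walk_sym : symmetric e -> forall k x y, walk e k x y -> walk e k y x.
Proof.
move=> es k x y /walkP[p [pp sp lp]]; apply/walkP; exists (rev (belast x p)).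
rewrite size_rev size_belast -lp -(@eq_path _ (fun z => e^~ z)); last by move=> u v; apply: es.
rewrite rev_path; split=> //; case: p pp sp lp => //= z p _ _ _.
by rewrite rev_cons last_rcons.
Qed.

Lemma gdistC : symmetric e -> forall x y, gdist e x y = gdist e y x.
Proof.
move=> es x y; apply: eq_bigl => k; apply/idP/idP; exact: walk_sym.
Qed.

Definition meet x y := [exists v, e x v && e y v].

Lemma meetC x y : meet x y = meet y x.
Proof. by apply: eq_existsb => v; rewrite andbC. Qed.

Lemma meetP x y : reflect (exists2 v, e x v & e y v) (meet x y).
Proof.
by apply: (iffP existsP) => [[v /andP[]]|[v ? ?]]; exists v => //; apply/andP.
Qed.

(** The test [t != Some (~~ s)] means that kind [inr t] allows neighbours on side [s]: always for a
    mid, only on its own side for a pendant. *)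
Record parted (k : T -> kind) : Prop := Parted {
  edge_sym : symmetric e;
  edge_irr : irreflexive e;
  edge_sides u v s s' : k u = inl s -> k v = inl s' -> e u v = (s != s');
  edge_out u v t : k u = inr t -> e u v ->
    exists2 s, k v = inl s & t != Some (~~ s);
  out_nbr u t s : k u = inr t -> t != Some (~~ s) ->
    exists2 v, k v = inl s & e u v;
  side_inhab s : exists v, k v = inl s }.

Definition kdist (k : T -> kind) u v : nat :=
  match k u, k v with
  | inl s, inl s' => if s == s' then if u == v then 0 else 2 else 1
  | inl s, inr (Some t) | inr (Some t), inl s =>
      if s == t then if e u v then 1 else 3 else 2
  | inl _, inr None | inr None, inl _ => if e u v then 1 else 2
  | inr (Some s), inr (Some t) =>
      if s == t then if u == v then 0 else if meet u v then 2 else 4 else 3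
  | inr None, inr None => if u == v then 0 else if meet u v then 2 else 3
  | inr _, inr _ => if meet u v then 2 else 3
  end.

Section Parted.
Context (k : T -> kind) (K : parted k).
Let esym := edge_sym K.
Let eirr := edge_irr K.

Lemma gdist0 u : gdist e u u = 0.
Proof. by apply: gdist_eq => //=. Qed.

Lemma walk1 u v : walk e 1 u v = e u v.
Proof.
apply/existsP/idP => [[z /= /andP[uz /eqP<-]] //|uv].
by exists v; rewrite /= uv eqxx.
Qed.

Lemma walk2 u v : walk e 2 u v = meet u v.
Proof.
apply: eq_existsb => z; rewrite -[[exists _, _]]/(walk e 1 z v) walk1.
by rewrite (esym v).
Qed.

Lemma gdist1 u v : e u v -> gdist e u v = 1.
Proof.
move=> uv; apply: gdist_eq => [|[|//] _]; first by rewrite walk1.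
by apply/eqP => uv'; rewrite uv' eirr in uv.
Qed.

Lemma gdist2 u v : u != v -> ~~ e u v -> meet u v -> gdist e u v = 2.
Proof.
move=> uv ne m; apply: gdist_eq => [|[|[|//]] _]; by rewrite ?walk2 ?walk1.
Qed.

Lemma gdist3 u v x : u != v -> ~~ e u v -> ~~ meet u v ->
  e u x -> meet x v -> gdist e u v = 3.
Proof.
move=> uv ne nm ux m; apply: gdist_eq => [|[|[|[|//]]] _]; rewrite ?walk2 ?walk1 //.
by apply/existsP; exists x; rewrite ux -/(walk e 2 x v) walk2.
Qed.

Lemma gdist4 u v x y : u != v -> ~~ e u v -> ~~ meet u v ->
  (forall z, e u z -> ~~ meet z v) -> e u x -> e x y -> meet y v ->
  gdist e u v = 4.
Proof.
move=> uv ne nm nm3 ux xy m; apply: gdist_eq => [|[|[|[|[|//]]]] _];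
  rewrite ?walk2 ?walk1 //.
  apply/existsP; exists x; rewrite ux; apply/existsP; exists y.
  by rewrite xy -/(walk e 2 y v) walk2.
apply/existsP => -[z /andP[uz]]; rewrite -/(walk e 2 z v) walk2; apply/negP.
exact: nm3.
Qed.

Lemma kind_neq u v : k u != k v -> u != v.
Proof. by apply: contra_neq => ->. Qed.

Lemma out_stable u v t t' : k u = inr t -> k v = inr t' -> e u v = false.
Proof.
move=> ku kv; apply/negP => uv; have [s] := edge_out K ku uv; by rewrite kv.
Qed.

Lemma gdist_sides u v s s' : k u = inl s -> k v = inl s' ->
  gdist e u v = if s == s' then if u == v then 0 else 2 else 1.
Proof.
move=> ku kv; case: eqP => [ss|/eqP ss]; last first.
  by apply: gdist1; rewrite (edge_sides K ku kv).
case: eqP => [->|/eqP uv]; first exact: gdist0.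
have [z kz] := side_inhab K (~~ s); apply: gdist2 => //.
  by rewrite (edge_sides K ku kv) ss eqxx.
apply/meetP; exists z; rewrite (edge_sides K ku kz, edge_sides K kv kz) -?ss;
  by case: (s).
Qed.

Lemma gdist_side_pend u v s t : k u = inl s -> k v = inr (Some t) ->
  gdist e u v = if s == t then if e u v then 1 else 3 else 2.
Proof.
move=> ku kv; have uv : u != v by apply: kind_neq; rewrite ku kv.
have [|x kx vx] := out_nbr K (s := t) kv; first by case: (t).
case: (altP (s =P t)) => [st|st]; last first.
  apply: gdist2 => //.
    apply/negP; rewrite esym => /(edge_out K kv)[s']; rewrite ku => -[<-].
    by case: (s) (t) st => [] [].
  by apply/meetP; exists x; rewrite // (edge_sides K ku kx).
subst t; case: ifP => [|/negbT nuv]; first exact: gdist1.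
have [z kz] := side_inhab K (~~ s).
apply: (gdist3 (x := z)) => //.
- apply/meetP => -[w uw vw]; have [s' kw] := edge_out K kv vw.
  move: uw; rewrite (edge_sides K ku kw).
  by case: (s) (s') => [] [].
- by rewrite (edge_sides K ku kz); case: (s).
- by apply/meetP; exists x; rewrite // (edge_sides K kz kx); case: (s).
Qed.

Lemma gdist_side_mid u v s : k u = inl s -> k v = inr None ->
  gdist e u v = if e u v then 1 else 2.
Proof.
move=> ku kv; case: ifP => [|/negbT nuv]; first exact: gdist1.
have [|x kx vx] := out_nbr K (s := ~~ s) kv; first by [].
apply: gdist2 => //; first by apply: kind_neq; rewrite ku kv.
by apply/meetP; exists x; rewrite // (edge_sides K ku kx); case: (s).
Qed.

(** A neighbour of [u] on side [s] is adjacent to a neighbour of [v] on the other side, so three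
    steps suffice. This covers all pairs in [X] except two pendants of the same side. *)
Lemma gdist_out u v t t' s : k u = inr t -> k v = inr t' ->
  t != Some (~~ s) -> t' != Some s -> u != v ->
  gdist e u v = if meet u v then 2 else 3.
Proof.
move=> ku kv ts ts' uv; have nuv : ~~ e u v by rewrite (out_stable ku kv).
case: ifP => [m|/negbT m]; first exact: gdist2.
have [x kx ux] := out_nbr K ku ts.
have [|y ky vy] := out_nbr K (s := ~~ s) kv; first by rewrite negbK.
apply: (gdist3 (x := x)) => //.
by apply/meetP; exists y; rewrite // (edge_sides K kx ky); case: (s).
Qed.

Lemma meet_pend_opp u v s s' : k u = inr (Some s) -> k v = inr (Some s') ->
  s != s' -> meet u v = false.
Proof.
move=> ku kv ss'; apply/meetP => -[w /(edge_out K ku)[r kw +] /(edge_out K kv)[r' kw' +]].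
move: kw' ss'; rewrite kw => -[<-]; by case: (s) (s') (r) => [] [] [].
Qed.

(** All neighbours of both vertices lie in the stable side [s], so without a common one a path has
    to detour through the opposite side. *)
Lemma gdist_pend u v s : k u = inr (Some s) -> k v = inr (Some s) ->
  u != v -> gdist e u v = if meet u v then 2 else 4.
Proof.
move=> ku kv uv; have nuv : ~~ e u v by rewrite (out_stable ku kv).
case: ifP => [m|/negbT m]; first exact: gdist2.
have [|x kx ux] := out_nbr K (s := s) ku; first by case: (s).
have [|y ky vy] := out_nbr K (s := s) kv; first by case: (s).
have [z kz] := side_inhab K (~~ s).
apply: (gdist4 (x := x) (y := z)) => //.
- move=> w /(edge_out K ku)[r kw sr]; apply/meetP => -[w' ww' /(edge_out K kv)[r' kw' sr']].
  move: ww'; rewrite (edge_sides K kw kw').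
  by case: (s) (r) (r') sr sr' => [] [] [].
- by rewrite (edge_sides K kx kz); case: (s).
- by apply/meetP; exists y; rewrite // (edge_sides K kz ky); case: (s).
Qed.

Lemma gdistE u v : gdist e u v = kdist k u v.
Proof.
have gC := gdistC esym.
rewrite /kdist; case ku: (k u) => [s|[s|]]; case kv: (k v) => [s'|[s'|]].
- exact: gdist_sides.
- exact: gdist_side_pend.
- exact: gdist_side_mid ku kv.
- by rewrite gC (esym u) (gdist_side_pend kv ku).
- have [ss|ss] := eqVneq s s'; last first.
    rewrite (gdist_out (s := s) ku kv) ?(meet_pend_opp ku kv) //.
    + by case: (s).
    + by rewrite eq_sym; apply: contra_neq ss => -[].
    + by apply: kind_neq; rewrite ku kv; apply: contra_neq ss => -[].
  case: eqP => [->|/eqP uv]; first exact: gdist0.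
  by apply: gdist_pend ku _ uv; rewrite kv ss.
- by rewrite (gdist_out (s := s) ku kv) //; [case: (s) | apply: kind_neq; rewrite ku kv].
- by rewrite gC (esym u) (gdist_side_mid kv ku).
- by rewrite (gdist_out (s := ~~ s') ku kv) //; [case: (s') | apply: kind_neq; rewrite ku kv].
- case: eqP => [->|/eqP uv]; first exact: gdist0.
  exact: (gdist_out (s := true)) ku kv _ _ uv.
Qed.

(** * Explicit lines *)

Lemma kdistC u v : kdist k u v = kdist k v u.
Proof. by rewrite -!gdistE (gdistC esym). Qed.

Lemma in_lineE u v w :
  (w \in line e u v) =
    [|| w == u, w == v, kdist k u v + kdist k w v == kdist k w u,
        kdist k u v + kdist k w u == kdist k w v
      | kdist k w u + kdist k w v == kdist k u v].
Proof.
rewrite inE /collinear /between !gdistE (kdistC v w) (kdistC v u) (kdistC u w).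
by [].
Qed.

Lemma line_ends u v : (u \in line e u v) * (v \in line e u v).
Proof. by rewrite !in_lineE !eqxx orbT. Qed.

Lemma meet_via u v w : e u w -> e v w -> meet u v.
Proof. by move=> uw vw; apply/meetP; exists w. Qed.

(** Once the kind of [w] is fixed, membership depends on a few bits of adjacency, meeting and
    equality; the instances of [meet_via] discard the impossible combinations. *)
Ltac line_mem s u v w ku kv :=
  have := @meet_via w u v; have := @meet_via w v u; have := @meet_via u v w;
  rewrite ?(esym u w) ?(esym v w) ?(esym v u) ?(meetC v u);
  rewrite in_lineE /kdist ku kv;
  have [->|_] := eqVneq w u;
    [by rewrite ?ku ?eqxx ?orbT ?eirr //=;
     case: (s); case: (e u v) => //= *; rewrite ?orbT |];
  have [->|_] := eqVneq w v;
    [by rewrite ?kv ?eqxx ?orbT ?eirr ?(esym v u) //=;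
     case: (s); case: (e u v) => //= *; rewrite ?orbT |];
  case: (k w) => [[]|[[]|]]; case: (s) => /=; rewrite ?eqxx //=;
  case: (e w u); case: (e w v); case: (e u v); case: (meet u v);
  case: (meet w v); case: (meet w u); case: (u == v) => //=;
  first [done | by move=> /(_ isT isT) | by move=> _ /(_ isT isT) | by move=> _ _ /(_ isT isT)].

Lemma in_line_side s y y' w : k y = inl s -> k y' = inl s -> y != y' ->
  (w \in line e y y') =
  match k w with
  | inl t => (t == s) ==> (w == y) || (w == y')
  | inr (Some t) => (t == s) && (e w y || e w y')
  | inr None => e w y && e w y'
  end.
Proof. move=> ky ky' /negbTE yy'; move: (yy'); line_mem s y y' w ky ky'. Qed.

Lemma in_line_sides s y z w : k y = inl s -> k z = inl (~~ s) ->
  (w \in line e y z) = if k w is inr None then e w y (+) e w z else true.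
Proof. move=> ky kz; line_mem s y z w ky kz. Qed.

Lemma in_line_pend_side s x y w : k x = inr (Some s) -> k y = inl s -> e x y ->
  w \notin line e x y -> [/\ k w = inr None, ~~ e w y & meet w x].
Proof.
move=> kx ky xy; suff -> : (w \in line e x y) =
    if k w is inr None then e w y || ~~ meet w x else true.
  by case: (k w) => [//|[//|]]; rewrite negb_or negbK => /andP[].
move: xy; line_mem s x y w kx ky.
Qed.

Lemma in_line_pend_opp s x z w : k x = inr (Some s) -> k z = inl (~~ s) ->
  (w \in line e x z) =
  match k w with
  | inl t => (t == s) || (w == z)
  | inr (Some t) => if t == s then (w == x) || ~~ meet w x else e w z
  | inr None => e w z && ~~ meet w x
  end.
Proof. move=> kx kz; line_mem s x z w kx kz. Qed.

Lemma in_line_pend_mid s x b w : k x = inr (Some s) -> k b = inr None ->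
  (w \in line e x b) =
  match k w with
  | inl t => if t == s then if meet x b then e w b else e w x
             else ~~ meet x b && e w b
  | inr (Some t) => (t == s) && ((w == x) || [&& meet x b, meet w b & ~~ meet w x])
  | inr None => w == b
  end.
Proof. move=> kx kb; line_mem s x b w kx kb. Qed.

Lemma in_line_pend s x x' w : k x = inr (Some s) -> k x' = inr (Some s) ->
  x != x' -> ~~ meet x x' ->
  (w \in line e x x') =
  match k w with
  | inl t => (t == s) ==> e w x || e w x'
  | inr (Some t) => (t == s) && [|| w == x, w == x' | meet w x && meet w x']
  | inr None => meet w x && meet w x'
  end.
Proof. move=> kx kx' /negbTE xx'; move: (xx'); line_mem s x x' w kx kx'. Qed.

Lemma in_line_mid b b' w : k b = inr None -> k b' = inr None -> b != b' ->
  (w \in line e b b') =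
  match k w with
  | inl _ => if meet b b' then e w b && e w b' else e w b || e w b'
  | inr (Some _) => false
  | inr None => (w == b) || (w == b')
  end.
Proof. move=> kb kb' /negbTE bb'; move: (bb'); line_mem true b b' w kb kb'. Qed.

Lemma in_line_mid_side s b y w : k b = inr None -> k y = inl s ->
  (w \in line e b y) =
  match k w with
  | inl t => if e b y then e w b == (t == s) else if t == s then w == y else e w b
  | inr (Some t) => if e b y then (t == s) == meet w b
                    else [&& t == s, e w y & ~~ meet w b]
  | inr None => if e b y then (w == b) || e w y || ~~ meet w b
                else (w == b) || e w y && ~~ meet w b
  end.
Proof. move=> kb ky; line_mem s b y w kb ky. Qed.

End Parted.
End Graph.

(** * Bipartite graphs, and the vertex kinds of a bisplit graph *)

Section Connected.
Context (T : finType) (e : rel T).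
Hypotheses (esym : symmetric e) (eirr : irreflexive e) (econ : connected_graph e).

Lemma gdist_walk x y : walk e (gdist e x y) x y.
Proof.
have [p pp lp] := connectP (econ x y).
have ex : exists n, walk e n x y by exists (size p); apply/walkP; exists p.
case: (ex_minnP ex) => m wm min; rewrite (gdist_eq wm) // => j jm.
by apply/negP => /min; rewrite leqNgt jm.
Qed.

(** The distances from any vertex to the ends of an edge differ by at most one, and their parities
    differ, so they differ by exactly one. *)
Lemma bipartite_universal (c : T -> bool) x y :
  (forall u v, e u v -> c u != c v) -> e x y -> line e x y = setT.
Proof.
move=> cE xy.
have par n u v : walk e n u v -> odd n = (c u != c v).
  elim: n u => [|n IH] u /=; first by move/eqP ->; rewrite eqxx.
  by case/existsP => z /andP[/cE uz /IH ->]; move: uz; case: (c u) (c z) (c v) => [] [] [].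
have d1 : gdist e x y = 1.
  apply: gdist_eq => [|[|//] _].
    by apply/existsP; exists y; rewrite xy /=.
  by apply/eqP => xy'; move/cE: xy; rewrite xy' eqxx.
have step u v w : e u v -> gdist e u w <= (gdist e v w).+1.
  move=> uv; apply: gdist_le; apply/existsP; exists v; rewrite uv; exact: gdist_walk.
apply/setP => w; rewrite !inE /collinear /between d1 (gdistC esym y x) d1.
have := step _ _ w xy; have := step y x w; rewrite esym => /(_ xy).
have := par _ _ _ (gdist_walk x w); have := par _ _ _ (gdist_walk y w).
rewrite (gdistC esym w y).
case: (c x) (c y) (c w) (cE _ _ xy) => [] [] [] //= _;
  move: (gdist e x w) (gdist e y w) => m n; lia.
Qed.

Lemma has_edge x : 1 < #|T| -> exists y, e x y.
Proof.
case/card_gt1P => u [v [_ _ uv]].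
have [y xy] : exists y, x != y.
  by have [xu|] := eqVneq x u; [exists v; rewrite xu | exists u].
case/connectP: (econ x y) => [[|z p]] /=; first by move=> _ yx; rewrite yx eqxx in xy.
by case/andP => xz _ _; exists z.
Qed.

Lemma bisplit_parted (X Y Z : {set T}) : 1 < #|T| ->
  [disjoint X & Y] -> [disjoint X & Z] -> [disjoint Y & Z] ->
  X :|: Y :|: Z = setT -> stable e X -> stable e Y -> stable e Z ->
  (forall y z, y \in Y -> z \in Z -> e y z) -> Y != set0 -> Z != set0 ->
  exists k : T -> kind, parted e k.
Proof.
move=> T1 XY XZ YZ XYZ sX sY sZ eYZ Y0 Z0.
have st A u v : stable e A -> u \in A -> v \in A -> e u v = false.
  by move=> /forall_inP h uA vA; apply/negbTE; apply: (forall_inP (h u uA)).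
have inX u : u \notin Y -> u \notin Z -> u \in X.
  by move=> uY uZ; have := in_setT u; rewrite -XYZ !inE (negbTE uY) (negbTE uZ) !orbF.
pose nb (A : {set T}) u := [exists v in A, e u v].
(* By connectivity every vertex of [X] has a neighbour, so one without neighbours in [Z] is a
   pendant of side [Y]. *)
pose k u : kind := if u \in Y then inl true else if u \in Z then inl false else
  inr (if ~~ nb Z u then Some true else if ~~ nb Y u then Some false else None).
have kY u : u \in Y -> k u = inl true by rewrite /k => ->.
have kZ u : u \in Z -> k u = inl false.
  by move=> uZ; rewrite /k uZ (disjointFl YZ uZ).
have kl u s : k u = inl s -> u \in if s then Y else Z.
  by rewrite /k; case: ifP => [? [<-] //|_]; case: ifP => [? [<-]|].
have kr u t : k u = inr t -> u \in X /\
    t = (if ~~ nb Z u then Some true else if ~~ nb Y u then Some false else None).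
  rewrite /k; case: ifP => // /negbT uY; case: ifP => // /negbT uZ [<-].
  by split=> //; apply: inX.
have nY u v : u \in X -> e u v -> (v \in Y) || (v \in Z).
  move=> uX uv; apply/negPn/negP; rewrite negb_or => /andP[vY vZ].
  by rewrite (st X u v sX uX (inX v vY vZ)) in uv.
exists k; split => //.
- move=> u v s s' /kl + /kl.
  case: s s' => [] [] hu hv; rewrite ?(st _ _ _ sY hu hv) ?(st _ _ _ sZ hu hv) //.
    by rewrite eYZ.
  by rewrite esym eYZ.
- move=> u v t /kr[uX ->] uv.
  case/orP: (nY _ _ uX uv) => [vY|vZ].
    exists true; first exact: kY.
    have -> : nb Y u by apply/exists_inP; exists v.
    by case: ifP.
  exists false; first exact: kZ.
  have -> : nb Z u by apply/exists_inP; exists v.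
  by case: (nb Y u).
- move=> u t s /kr[uX ->] ts.
  have [w uw] := has_edge u T1.
  have : nb (if s then Y else Z) u.
    case: s ts; case: (boolP (nb Z u)) => //= nZ; case: (boolP (nb Y u)) => //= nYu _.
    case/orP: (nY _ _ uX uw) => wY; first by case/exists_inP: nYu; exists w.
    by case/exists_inP: nZ; exists w.
  case/exists_inP => v vs uv; exists v => //.
  by case: (s) vs => [/kY|/kZ].
- by case; [have /set0Pn[v /kY] := Y0 | have /set0Pn[v /kZ] := Z0]; exists v.
Qed.

End Connected.

(** * Families of lines *)

Section Families.
Context (T : finType) (e : rel T).

(** Families are described by properties so that counts add up as soon as the properties are
    incompatible. *)
Definition fam (P : {set T} -> Prop) n :=
  exists F : {set {set T}}, [/\ F \subset lines e, n <= #|F| & forall L, L \in F -> P L].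

Lemma line_in_lines u v : u != v -> line e u v \in lines e.
Proof. by move=> uv; apply/imsetP; exists (u, v); rewrite ?inE. Qed.

Lemma fam_add P Q n m : fam P n -> fam Q m -> (forall L, P L -> Q L -> False) ->
  fam (fun L => P L \/ Q L) (n + m).
Proof.
move=> [F [Fl nF FP]] [G [Gl mG GQ]] PQ; exists (F :|: G); split.
- by rewrite subUset Fl.
- rewrite cardsU (_ : F :&: G = set0) ?cards0 ?subn0 ?leq_add //.
  by apply/setP => L; rewrite !inE; apply/andP => -[/FP p /GQ]; apply: PQ.
- by move=> L; rewrite inE => /orP[/FP|/GQ]; [left|right].
Qed.

Lemma fam_sub P Q n m : fam P n -> (forall L, P L -> Q L) -> m <= n -> fam Q m.
Proof.
by move=> [F [Fl nF FP]] PQ mn; exists F; split=> [||L /FP /PQ] //; apply: leq_trans nF.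
Qed.

Lemma fam0 P : fam P 0.
Proof. by exists set0; split=> [||L]; rewrite ?sub0set ?inE. Qed.

Lemma fam_img (U : finType) (D : {set U}) (f g : U -> T) :
  {in D, forall i, f i != g i} -> {in D &, injective (fun i => line e (f i) (g i))} ->
  fam (fun L => exists2 i, i \in D & L = line e (f i) (g i)) #|D|.
Proof.
move=> fg inj; exists [set line e (f i) (g i) | i in D]; split.
- by apply/subsetP => _ /imsetP[i iD ->]; apply/line_in_lines/fg.
- by rewrite card_in_imset.
- by move=> L /imsetP.
Qed.

Lemma fam1 u v : u != v -> fam (fun L => L = line e u v) 1.
Proof.
move=> uv; exists [set line e u v]; rewrite sub1set line_in_lines ?cards1 //.
by split=> // L; rewrite inE => /eqP.
Qed.

Lemma fam_card P n : fam P n -> n <= #|lines e|.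
Proof. by move=> [F [Fl nF _]]; apply: leq_trans nF (subset_leq_card Fl). Qed.

End Families.

Lemma card_fiber (U V : finType) (D : {set U}) (f : U -> V) c :
  {in D, forall x, #|[set x' in D | f x' == f x]| <= c} -> #|D| <= c * #|f @: D|.
Proof.
move=> fib; rewrite -sum1_card (partition_big_imset f) /= mulnC -sum_nat_const.
apply: leq_sum => _ /imsetP[x xD ->]; apply: leq_trans (fib x xD).
by rewrite sum1_card; apply/eq_leq/eq_card => x'; rewrite !inE.
Qed.

(** * As many lines as pendants *)

Section NoUniversalLine.
Context (T : finType) (e : rel T) (k : T -> kind) (K : parted e k).
Hypothesis nu : forall u v, u != v -> exists w, w \notin line e u v.
Let esym := edge_sym K.

Definition side s := [set u | k u == inl s].
Definition pend s := [set u | k u == inr (Some s)].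
Definition mid := [set u | k u == inr None].

Lemma sideP s u : reflect (k u = inl s) (u \in side s).
Proof. by rewrite inE; apply: eqP. Qed.
Lemma pendP s u : reflect (k u = inr (Some s)) (u \in pend s).
Proof. by rewrite inE; apply: eqP. Qed.
Lemma midP u : reflect (k u = inr None) (u \in mid).
Proof. by rewrite inE; apply: eqP. Qed.

Lemma line_neq (L L' : {set T}) w : w \in L -> w \notin L' -> L <> L'.
Proof. by move=> wL wL' LL'; rewrite LL' (negbTE wL') in wL. Qed.

(** An edge between the sides generates a line that can miss only such mids, and it is not
    universal. *)
Lemma mid_unsplit s y z : k y = inl s -> k z = inl (~~ s) ->
  exists2 b, k b = inr None & e b y = e b z.
Proof.
move=> ky kz; have [|w] := nu (u := y) (v := z).
  by apply: (@kind_neq _ k); rewrite ky kz; case: (s).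
rewrite (in_line_sides K _ ky kz); case kw: (k w) => [|[]] // h.
by exists w => //; move: h; case: (e w y) (e w z) => [] [].
Qed.

Lemma pend_nbr s x y : k x = inr (Some s) -> e x y -> k y = inl s.
Proof.
by move=> kx /(edge_out K kx)[r ->]; case: (r) (s) => [] [].
Qed.

Lemma mid_avoid s x y : k x = inr (Some s) -> e x y ->
  exists b, [/\ k b = inr None, ~~ e b y & meet e b x].
Proof.
move=> kx xy; have ky := pend_nbr kx xy.
have [|w] := nu (u := x) (v := y); first by apply: (@kind_neq _ k); rewrite ky kx.
by move/(in_line_pend_side K kx ky xy) => h; exists w.
Qed.

Lemma pend_has s x : k x = inr (Some s) -> exists2 y, k y = inl s & e x y.
Proof. by move=> kx; apply: (out_nbr K kx); case: (s). Qed.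

Lemma mid_has s x : k x = inr None -> exists2 y, k y = inl s & e x y.
Proof. by move=> kx; apply: (out_nbr K kx). Qed.

Lemma pend_deg2 s x : k x = inr (Some s) ->
  exists y y', [/\ y != y', e x y & e x y'].
Proof.
move=> kx; have [y _ xy] := pend_has kx.
have [b [kb bny /(meetP)[y' by' xy']]] := mid_avoid kx xy.
by exists y, y'; split=> //; apply: contraNneq bny => ->.
Qed.

(** A mid avoiding one neighbour [y] of [x] is adjacent to another neighbour [y']; a mid avoiding
    [y'] is then a different one. *)
Lemma mid_gt1 s x : k x = inr (Some s) ->
  exists b b', [/\ k b = inr None, k b' = inr None & b != b'].
Proof.
move=> kx; have [y _ xy] := pend_has kx.
have [b [kb bny /(meetP)[y' by' xy']]] := mid_avoid kx xy.
have [b' [kb' bny' _]] := mid_avoid kx xy'.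
by exists b, b'; split=> //; apply: contraTneq by' => ->.
Qed.

(* What separates the lines counted in [fam_pend] from all the other families. *)
Definition pend_like s (L : {set T}) :=
  [/\ exists2 x, k x = inr (Some s) & x \in L,
      forall x, k x = inr (Some (~~ s)) -> x \notin L,
      (forall z, k z = inl (~~ s) -> z \notin L) \/
        (exists2 y, k y = inl s & y \notin L)
    & forall y y', k y = inl s -> k y' = inl s -> y != y' -> L <> line e y y'].

(** If [x] and [b] meet, the line avoids the opposite side. Otherwise its part in side [s] is the
    neighbourhood of [x], which misses the neighbours of [b]. *)
Lemma pend_like_mid s x b : k x = inr (Some s) -> k b = inr None ->
  pend_like s (line e x b).
Proof.
move=> kx kb; have lE := in_line_pend_mid K _ kx kb.
have [z kz bz] := mid_has (~~ s) kb.
have [y ky bY] := mid_has s kb.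
have ns : (~~ s == s) = false by case: (s).
split.
- by exists x; rewrite ?(line_ends K).
- by move=> w kw; rewrite lE kw ns.
- case: (boolP (meet e x b)) => m; [left|right].
    by move=> w kw; rewrite lE kw ns m.
  exists y => //; rewrite lE ky eqxx (negbTE m).
  by apply: contraNN m => yx; apply/meetP; exists y => //; rewrite esym.
- move=> u v ku kv uv; have l2E := in_line_side K _ ku kv uv.
  case: (boolP (meet e x b)) => m.
    apply/nesym/(@line_neq _ _ z); first by rewrite l2E kz ns.
    by rewrite lE kz ns m.
  (* As [b] is on the line, it is adjacent to [u]; as [u] is on it, [u] is adjacent to [x]. So [x]
     and [b] would meet. *)
  have bl : b \in line e x b by rewrite (line_ends K).
  move=> E; have ul : u \in line e x b by rewrite E (line_ends K).
  move: bl ul; rewrite E {1}l2E -E lE kb ku eqxx (negbTE m) => /andP[bu _] ux.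
  by case/negP: m; apply/meetP; exists u; rewrite // esym.
Qed.

(** A neighbour of [x3] is the missing vertex of side [s]. The disjoint neighbourhoods of [x1] and
    [x2], each with at least two vertices, are too large for a line generated inside side [s]. *)
Lemma pend_like_pair s x1 x2 x3 :
  k x1 = inr (Some s) -> k x2 = inr (Some s) -> k x3 = inr (Some s) -> x1 != x2 ->
  ~~ meet e x1 x2 -> ~~ meet e x1 x3 -> ~~ meet e x2 x3 ->
  pend_like s (line e x1 x2).
Proof.
move=> k1 k2 k3 n12 m12 m13 m23; have lE := in_line_pend K _ k1 k2 n12 m12.
have ns : (~~ s == s) = false by case: (s).
split.
- by exists x1; rewrite ?(line_ends K).
- by move=> w kw; rewrite lE kw ns.
- have [y ky xy] := pend_has k3; right; exists y => //.
  rewrite lE ky eqxx /= negb_or; apply/andP; split.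
    by apply: contraNN m13 => h; apply/meetP; exists y; rewrite // esym.
  by apply: contraNN m23 => h; apply/meetP; exists y; rewrite // esym.
- have [y [y' [yy' xy xy']]] := pend_deg2 k1.
  have [z [z' [zz' xz xz']]] := pend_deg2 k2.
  have ne u v : e x1 u -> e x2 v -> u != v.
    by move=> h h'; apply: contraNneq m12 => uv; apply/meetP; exists u; rewrite // uv.
  have side_l w : e x1 w || e x2 w -> k w = inl s /\ w \in line e x1 x2.
    move=> h; have kw : k w = inl s by case/orP: h; apply: pend_nbr.
    by rewrite lE kw eqxx /= !(esym w).
  move=> u v ku kv uv E; have l2E := in_line_side K _ ku kv uv.
  have in2 w : e x1 w || e x2 w -> (w == u) || (w == v).
    by move/side_l => [kw]; rewrite E l2E kw eqxx.
  have := in2 y; have := in2 y'; have := in2 z.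
  rewrite xy xy' xz !orbT.
  move=> /(_ isT) /orP[] /eqP Ez /(_ isT) /orP[] /eqP Ey' /(_ isT) /orP[] /eqP Ey.
  all: move: yy' (ne _ _ xy xz) (ne _ _ xy' xz); by rewrite Ey Ey' Ez ?eqxx.
Qed.

(** * Pendants whose lines to a fixed mid coincide *)

Section Twins.
Context (s : bool) (b : T).
Hypothesis kb : k b = inr None.
Let f x := line e x b.

(** Since [x'] lies on the line [xb], both pendants meet [b] and are disjoint; comparing the other
    pendants on the two equal lines gives the last clause. *)
Lemma twins x x' : k x = inr (Some s) -> k x' = inr (Some s) -> x != x' ->
  f x = f x' ->
  [/\ ~~ meet e x x', meet e x b, meet e x' b &
    forall w, k w = inr (Some s) -> w != x -> w != x' -> meet e w b ->
      meet e w x = meet e w x'].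
Proof.
move=> kx kx' xx' E.
have h u w : k u = inr (Some s) -> k w = inr (Some s) ->
   (w \in f u) = (w == u) || [&& meet e u b, meet e w b & ~~ meet e w u].
  by move=> ku kw; rewrite (in_line_pend_mid K _ ku kb) kw eqxx.
have : x' \in f x by rewrite E (line_ends K).
rewrite h // eq_sym (negbTE xx') /= => /and3P[m m' d].
split=> //; first by rewrite meetC.
move=> w kw /negbTE wx /negbTE wx' wm.
have := h x w kx kw; rewrite E h // wx wx' m m' wm /=.
by case: (meet e w x) (meet e w x') => [] [].
Qed.

Definition class x := [set x' in pend s | f x' == f x].
Definition big := [set x in pend s | 2 < #|class x|].

(* Classes of size at most two lose a factor two, compensated by a second mid. *)
Lemma small_classes : #|pend s :\: big| <= 2 * #|f @: pend s|.
Proof.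
apply: leq_trans (_ : _ <= 2 * #|f @: (pend s :\: big)|) _; last first.
  by rewrite leq_mul2l subset_leq_card ?orbT // imsetS // subsetDl.
apply: card_fiber => x /setDP[xp]; rewrite inE xp /= -leqNgt; apply: leq_trans.
by apply: subset_leq_card; apply/subsetP => w; rewrite !inE => /andP[/andP[_ ->] ->].
Qed.

(** The pairs are ordered, so every pair of twins in a large class occurs twice. *)
Definition twin_pairs :=
  [set p : T * T | [&& p.1 \in big, p.2 \in class p.1 & p.2 != p.1]].

Lemma card_twin_pairs : 2 * #|big| <= #|twin_pairs|.
Proof.
rewrite -[#|twin_pairs|]sum1_card (partition_big (fun p => p.1) (mem big)) /=; last first.
  by move=> p; rewrite inE => /and3P[].
rewrite mulnC -sum_nat_const; apply: leq_sum => x xb.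
rewrite sum1dep_card.
have : 2 < #|class x| by move: xb; rewrite inE => /andP[].
rewrite (cardsD1 x) [x \in class x]inE eqxx andbT.
have -> : x \in pend s by move: xb; rewrite inE => /andP[].
rewrite add1n ltnS => /leq_trans; apply.
rewrite -(card_imset _ (f := fun y => (x, y))); last by move=> ? ? [].
apply: subset_leq_card; apply/subsetP => _ /imsetP[y yc ->].
rewrite !inE /= in yc xb *; rewrite xb eqxx.
by case/andP: yc => -> ->.
Qed.

Lemma twin_pairP p : p \in twin_pairs ->
  exists x3, [/\ [/\ k p.1 = inr (Some s), k p.2 = inr (Some s) & k x3 = inr (Some s)],
    [/\ p.1 != p.2, p.1 != x3 & p.2 != x3], f p.1 = f p.2 & f p.1 = f x3].
Proof.
rewrite !inE => /and3P[/andP[/eqP k1 big1] /andP[/eqP k2 /eqP E] n12].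
have : 0 < #|class p.1 :\ p.1 :\ p.2|.
  have p1c : p.1 \in class p.1 by rewrite !inE k1 !eqxx.
  have p2c : p.2 \in class p.1 :\ p.1 by rewrite !inE n12 k2 E !eqxx.
  move: big1; rewrite (cardsD1 p.1) p1c (cardsD1 p.2) p2c; lia.
case/card_gt0P => x3; rewrite !inE => /and4P[n23 n13 /eqP k3 /eqP E3].
by exists x3; split=> //; split=> //; rewrite eq_sym.
Qed.

(* A third twin of [p] avoids the line [p.1 p.2 = q.1 q.2], hence is disjoint from
   both [q.1] and [q.2], and then so are its twins [p.1] and [p.2]. *)
Lemma twin_line_inj p q : p \in twin_pairs -> q \in twin_pairs ->
  line e p.1 p.2 = line e q.1 q.2 ->
  ((p.1 == q.1) || (p.1 == q.2)) && ((p.2 == q.1) || (p.2 == q.2)).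
Proof.
move=> /twin_pairP[p3 [[k1 k2 k3] [n12 n13 n23] E2 E3]].
move=> /twin_pairP[q3 [[l1 l2 l3] [o12 o13 o23] F2 F3]] E.
have [d12 m1 m2 _] := twins k1 k2 n12 E2.
have [d13 _ m3 _] := twins k1 k3 n13 E3.
have [c12 r1 r2 hq] := twins l1 l2 o12 F2.
have lqE := in_line_pend K _ l1 l2 o12 c12.
have p3L : p3 \notin line e q.1 q.2.
  rewrite -E (in_line_pend K _ k1 k2 n12 d12) k3 eqxx eq_sym (negbTE n13).
  by rewrite eq_sym (negbTE n23) meetC (negbTE d13).
have p3q1 : p3 != q.1 by apply: contraNneq p3L => ->; rewrite (line_ends K).
have p3q2 : p3 != q.2 by apply: contraNneq p3L => ->; rewrite (line_ends K).
have nm : meet e p3 q.1 = false.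
  have := hq p3 k3 p3q1 p3q2 m3; move: p3L.
  rewrite lqE k3 eqxx (negbTE p3q1) (negbTE p3q2) /=.
  by case: (meet e p3 q.1) => //= /negbTE ->.
have main x : k x = inr (Some s) -> x != p3 -> f x = f p3 -> x \in line e q.1 q.2 ->
    (x == q.1) || (x == q.2).
  move=> kx xp3 Ex; rewrite lqE kx eqxx /=.
  have [//|xq1] := eqVneq x q.1; have [//|xq2] /= := eqVneq x q.2.
  have [_ _ _ hx] := twins kx k3 xp3 Ex.
  by rewrite meetC hx // 1?eq_sym // (meetC _ q.1) nm.
apply/andP; split; apply: main; rewrite -?E ?(line_ends K) //.
by rewrite -E2.
Qed.

(** A line can come only from a pair and its swap. *)
Lemma card_twin_lines :
  #|twin_pairs| <= 2 * #|[set line e p.1 p.2 | p in twin_pairs]|.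
Proof.
apply: card_fiber => p pt; apply: leq_trans (_ : #|[set (p.1, p.2); (p.2, p.1)]| <= 2).
  apply: subset_leq_card; apply/subsetP => q; rewrite inE => /andP[qt /eqP E]; rewrite !inE.
  have := twin_line_inj qt pt E; have /twin_pairP[_ [_ [+ _ _] _ _]] := qt.
  case: q p {pt qt E} => q1 q2 [p1 p2] /= q12.
  by case/andP => /orP[] /eqP E1 /orP[] /eqP E2; move: q12; rewrite E1 E2 ?eqxx ?orbT.
by rewrite cards2; case: eqP.
Qed.
End Twins.

Lemma mid_inj s x x' b b' :
  k x = inr (Some s) -> k x' = inr (Some s) -> k b = inr None -> k b' = inr None ->
  line e x b = line e x' b' -> b = b'.
Proof.
move=> kx kx' kb kb' E; apply/eqP.
have : b \in line e x b by rewrite (line_ends K).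
by rewrite E (in_line_pend_mid K _ kx' kb') kb.
Qed.

Lemma fam_pend s : fam e (pend_like s) #|pend s|.
Proof.
have [->|/set0Pn[x0 /pendP kx0]] := eqVneq (pend s) set0.
  by rewrite cards0; apply: fam0.
have [b [b' [kb kb' bb']]] := mid_gt1 kx0.
(* The twin lines are taken at the mid with more pendants in large classes. *)
wlog le : b b' kb kb' bb' / #|big s b'| <= #|big s b|.
  move=> W; case/orP: (leq_total #|big s b'| #|big s b|) => le.
    exact: (W b b').
  by apply: (W b' b); rewrite // eq_sym.
pose F c := [set line e x c | x in pend s].
pose G := [set line e p.1 p.2 | p in twin_pairs s b].
have Fpend c L : k c = inr None -> L \in F c -> pend_like s L.
  by move=> kc /imsetP[x /pendP kx ->]; apply: pend_like_mid.
have xc x c : x \in pend s -> k c = inr None -> x != c.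
  by move=> /pendP kx kc; apply: (@kind_neq _ k); rewrite kx kc.
(* A line of [G] contains the whole opposite side. On a line [xc] this forces [x] and [c] not to
   meet, and then [x] is the only pendant there. *)
have FG c L : k c = inr None -> L \in F c -> L \in G -> False.
  move=> kc /imsetP[x /pendP kx ->] /imsetP[p /twin_pairP[x3 [[k1 k2 k3] [n12 _ _] E2 _]] E].
  have [d12 _ _ _] := twins kb k1 k2 n12 E2.
  have lE := in_line_pend_mid K _ kx kc.
  have [z kz] := side_inhab K (~~ s).
  have ns : (~~ s == s) = false by case: (s).
  have : z \in line e x c by rewrite E (in_line_pend K _ k1 k2 n12 d12) kz ns.
  rewrite lE kz ns => /andP[/negbTE m _].
  have : p.1 \in line e x c by rewrite E (line_ends K).
  have : p.2 \in line e x c by rewrite E (line_ends K).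
  rewrite !lE k1 k2 eqxx m /= !orbF => /eqP E1 /eqP E2'.
  by rewrite E1 E2' eqxx in n12.
exists (F b :|: F b' :|: G); split.
- rewrite !subUset -andbA; apply/and3P; split; apply/subsetP => L /imsetP[].
  + by move=> x xs ->; apply/line_in_lines/xc.
  + by move=> x xs ->; apply/line_in_lines/xc.
  + by move=> p /twin_pairP[_ [_ [n _ _] _ _]] ->; apply: line_in_lines.
- rewrite cardsU (_ : (F b :|: F b') :&: G = set0) ?cards0 ?subn0; last first.
    apply/setP => L; rewrite !inE; apply/andP => -[/orP[] h].
      exact: (FG _ _ kb h).
    exact: (FG _ _ kb' h).
  rewrite cardsU (_ : F b :&: F b' = set0) ?cards0 ?subn0; last first.
    apply/setP => L; rewrite !inE; apply/andP => -[/imsetP[x /pendP kx ->] /imsetP[x' /pendP kx']].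
    by move/(mid_inj kx kx' kb kb') => E; rewrite E eqxx in bb'.
  have split c : #|big s c| + #|pend s :\: big s c| = #|pend s|.
    rewrite -[RHS](cardsID (big s c)) (setIidPr _) //.
    by apply/subsetP => x; rewrite inE => /andP[].
  (* [B], [B'] count the pendants in large classes for [b], [b'], and [D], [D'] the others. Since
     [D <= D'], the sum [m + m'] covers [D], while [n] covers [B]. *)
  have arith a B B' D D' P m m' n : B' <= B -> B + D = a -> B' + D' = a ->
    D <= 2 * m -> D' <= 2 * m' -> 2 * B <= P -> P <= 2 * n -> a <= m + m' + n by lia.
  exact: arith le (split b) (split b') (small_classes s b) (small_classes s b')
    (card_twin_pairs s b) (card_twin_lines s kb).
- move=> L; rewrite !inE -orbA => /or3P[||]; [exact: Fpend|exact: Fpend|].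
  move=> /imsetP[p /twin_pairP[x3 [[k1 k2 k3] [n12 n13 n23] E2 E3]] ->].
  have [d12 _ _ _] := twins kb k1 k2 n12 E2.
  have [d13 _ _ _] := twins kb k1 k3 n13 E3.
  have [d23 _ _ _] := twins kb k2 k3 n23 (etrans (Logic.eq_sym E2) E3).
  exact: pend_like_pair k1 k2 k3 n12 d12 d13 d23.
Qed.
End NoUniversalLine.

(** * Graphs with a pendant *)

Section WithPendant.
Context (T : finType) (e : rel T) (k : T -> kind) (K : parted e k).
Hypothesis nu : forall u v, u != v -> exists w, w \notin line e u v.

Lemma card_kinds s :
  #|T| = #|side k s| + #|side k (~~ s)| + #|pend k s| + #|pend k (~~ s)| + #|mid k|.
Proof.
have cE (A : {set T}) : #|A| = \sum_x (x \in A : nat).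
  by rewrite -sum1_card big_mkcond; apply: eq_bigr => x _; case: (x \in A).
rewrite !cE -!big_split /= -sum1_card; apply: eq_bigr => x _; rewrite !inE.
by case: (k x) => [[]|[[]|]]; case: (s).
Qed.

(** These are the lines from [y1] to the rest of its side, together with one line from [y2] to a
    third vertex [y3]. *)
Lemma fam_side_pairs s y1 y2 : k y1 = inl s -> k y2 = inl s -> y1 != y2 ->
  2 < #|side k s| ->
  fam e (fun L => exists y y', [/\ k y' = inl s, y != y', (y == y1) || (y == y2)
                                 & L = line e y y']) #|side k s|.
Proof.
move=> k1 k2 n12 gt2.
have [y3] : exists y3, y3 \in side k s :\ y1 :\ y2.
  apply/set0Pn; rewrite -card_gt0; move: gt2.
  by rewrite (cardsD1 y1) (cardsD1 y2 (_ :\ _)) !inE k1 k2 eqxx eq_sym n12.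
rewrite !inE => /and3P[n32 n31 /eqP k3].
(* The index [y1] stands for the extra line [y2y3], the only one that misses [y1]. *)
pose f i := if i == y1 then y2 else y1; pose g i := if i == y1 then y3 else i.
have fgP i : i \in side k s ->
    [/\ k (f i) = inl s, k (g i) = inl s, f i != g i & (f i == y1) || (f i == y2)].
  move/sideP => ki; rewrite /f /g.
  by case: (eqVneq i y1) => [_|ni]; split=> //; rewrite ?eqxx ?orbT // eq_sym.
have y1P i : i \in side k s -> (y1 \in line e (f i) (g i)) = (i != y1).
  move=> /fgP[kf kg fg _]; rewrite (in_line_side K _ kf kg fg) k1 eqxx /f /g.
  by case: (eqVneq i y1) => [_|]; rewrite ?eqxx // (negbTE n12) eq_sym (negbTE n31).
apply: (@fam_sub _ _ _ _ #|side k s|); first apply: (@fam_img _ _ _ (side k s) f g).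
- by move=> i /fgP[].
- move=> i j iY jY E; have : (i != y1) = (j != y1) by rewrite -!y1P // E.
  have [->|i1] := eqVneq i y1; have [->|j1] := eqVneq j y1 => // _.
  have [kf kg fg _] := fgP j jY; have : i \in line e (f j) (g j).
    by rewrite -E /g (negbTE i1) (line_ends K).
  have /sideP ki := iY.
  by rewrite (in_line_side K _ kf kg fg) ki eqxx /f /g (negbTE j1) (negbTE i1) => /eqP.
- by move=> L [i /fgP[kf kg fg fy] ->]; exists (f i), (g i).
- by [].
Qed.

Lemma fam_mid b : k b = inr None ->
  fam e (fun L => exists b', [/\ k b' = inr None, b != b' & L = line e b b']) #|mid k|.-1.
Proof.
move=> kb; have bm : b \in mid k by apply/midP.
apply: (@fam_sub _ _ _ _ #|mid k :\ b|); first apply: (@fam_img _ _ _ (mid k :\ b) (fun=> b) id).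
- by move=> i; rewrite !inE eq_sym => /andP[].
- move=> i j; rewrite !inE => /andP[ib /eqP ki] /andP[jb /eqP kj] /= E.
  have bj : b != j by rewrite eq_sym.
  have : i \in line e b i by rewrite (line_ends K).
  by rewrite E (in_line_mid K _ kb kj bj) ki (negbTE ib) => /eqP.
- move=> L [i]; rewrite !inE => /andP[ib /eqP ki] ->; exists i.
  by rewrite eq_sym.
- by rewrite (cardsD1 b (mid k)) bm.
Qed.

Section Pendant.
Context (s : bool) (x0 : T).
Hypothesis kx0 : k x0 = inr (Some s).
Let ns : (~~ s == s) = false. Proof. by case: s. Qed.

Lemma fam_opp : fam e
  (fun L => exists2 z, k z = inl (~~ s) & L = line e x0 z) #|side k (~~ s)|.
Proof.
apply: (@fam_sub _ _ _ _ #|side k (~~ s)|);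
  first apply: (@fam_img _ _ _ (side k (~~ s)) (fun=> x0) id).
- by move=> z /sideP kz; apply: (@kind_neq _ k); rewrite kx0 kz.
- move=> z z' /sideP kz /sideP kz' /= E.
  have : z \in line e x0 z by rewrite (line_ends K).
  by rewrite E (in_line_pend_opp K _ kx0 kz') kz ns => /eqP.
- by move=> L [z /sideP kz ->]; exists z.
- by [].
Qed.

(** Equality would reduce the opposite side to [z']. A mid avoiding [y] and meeting [x0] is then
    adjacent to [z], so it lies on [yz] but not on [x0z']. *)
Lemma sides_line_neq y z z' : e x0 y -> k z = inl (~~ s) -> k z' = inl (~~ s) ->
  line e y z <> line e x0 z'.
Proof.
move=> xy kz kz' E; have ky := pend_nbr K kx0 xy.
have [b [kb nby m]] := mid_avoid K nu kx0 xy.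
have lE w : k w = inl (~~ s) -> w = z'.
  move=> kw; have : w \in line e y z by rewrite (in_line_sides K _ ky kz) kw.
  by rewrite E (in_line_pend_opp K _ kx0 kz') kw ns => /eqP.
have : b \notin line e y z by rewrite E (in_line_pend_opp K _ kx0 kz') kb m andbF.
rewrite (in_line_sides K _ ky kz) kb (negbTE nby) /=.
by have [w /lE -> bw] := mid_has K (~~ s) kb; rewrite (lE z kz) bw.
Qed.

(** To be added to any family whose lines each contain a pendant of side [s]. *)
Lemma fam_no_pend :
  fam e (fun L => forall x, k x = inr (Some s) -> x \notin L)
    (#|pend k (~~ s)| + #|mid k|.-1).
Proof.
have [b [_ [kb _ _]]] := mid_gt1 K nu kx0.
have bbN b' x t : k b' = inr None -> b != b' -> k x = inr (Some t) -> x \notin line e b b'.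
  by move=> kb' bb' kx; rewrite (in_line_mid K _ kb kb' bb') kx.
have /(fam_add (fam_pend K nu (~~ s)) (fam_mid kb)) F : forall L,
    pend_like e k (~~ s) L ->
    (exists b', [/\ k b' = inr None, b != b' & L = line e b b']) -> False.
  move=> L [[x kx xL] _ _ _] [b' [kb' bb' E]].
  by move: xL; rewrite E (negbTE (bbN b' x _ kb' bb' kx)).
apply: fam_sub F _ (leqnn _) => L [[_ + _ _]|[b' [kb' bb' ->]]] x kx; last exact: bbN kx.
by apply; rewrite negbK.
Qed.

(** Shared by the lines [x0z] and [yz], and incompatible with [pend_like], whose lines avoid the
    opposite side or miss a vertex of side [s]. *)
Definition full (L : {set T}) :=
  [/\ x0 \in L, forall y, k y = inl s -> y \in L & exists2 z, k z = inl (~~ s) & z \in L].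

Lemma pend_like_not_full L : pend_like e k s L -> full L -> False.
Proof.
move=> [_ _ [ZL|[y ky /negP yL]] _] [_ YL [z kz]]; first exact/negP/ZL.
by case: yL; apply: YL.
Qed.

Lemma full_sides y z : k y = inl s -> k z = inl (~~ s) -> full (line e y z).
Proof.
move=> ky kz; have lE := in_line_sides K _ ky kz.
by split=> [|w kw|]; [rewrite lE kx0|rewrite lE kw|exists z; rewrite ?(line_ends K)].
Qed.

Lemma full_opp z : k z = inl (~~ s) -> full (line e x0 z).
Proof.
move=> kz; split=> [|w kw|]; first by rewrite (line_ends K).
  by rewrite (in_line_pend_opp K _ kx0 kz) kw eqxx.
by exists z; rewrite ?(line_ends K).
Qed.

Lemma fam_full y z : e x0 y -> k z = inl (~~ s) ->
  fam e (fun L => (exists2 z, k z = inl (~~ s) & L = line e x0 z) \/ L = line e y z)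
    (#|side k (~~ s)| + 1).
Proof.
move=> xy kz; apply: fam_add; first exact: fam_opp.
  apply: fam1; apply: (@kind_neq _ k); rewrite (pend_nbr K kx0 xy) kz.
  by case: (s).
by move=> L [z' kz' ->] h; apply: (sides_line_neq xy kz kz' (Logic.eq_sym h)).
Qed.

Lemma card_lines_pend P n : fam e P n ->
  (forall L, P L -> exists2 x, k x = inr (Some s) & x \in L) ->
  n + (#|pend k (~~ s)| + #|mid k|.-1) <= #|lines e|.
Proof.
move=> F PL; apply: (fam_card (fam_add F fam_no_pend _)) => L /PL[x kx xL] /(_ x kx).
by rewrite xL.
Qed.

Lemma mid_pos : 1 < #|mid k|.
Proof.
have [b [b' [kb kb' bb']]] := mid_gt1 K nu kx0.
by apply/card_gt1P; exists b, b'; split=> //; apply/midP.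
Qed.

(** There is one line per pendant of side [s], one per vertex of side [s], one per opposite vertex
    plus the line [y1z], and those of [fam_no_pend]; [y1z] makes up for the one lost among the
    mids. *)
Lemma many_lines_pend_gt2 : 2 < #|side k s| -> #|T| <= #|lines e|.
Proof.
move=> gt2.
have [y1 [y2 [n12 xy1 xy2]]] := pend_deg2 K nu kx0.
have k1 := pend_nbr K kx0 xy1; have k2 := pend_nbr K kx0 xy2.
have [z kz] := side_inhab K (~~ s).
(* Since [y1] and [y2] are neighbours of [x0], every line of [fam_side_pairs] contains [x0]. *)
have x0Y y y' : k y' = inl s -> y != y' -> (y == y1) || (y == y2) ->
    k y = inl s /\ x0 \in line e y y'.
  move=> ky' yy' yy; have ky : k y = inl s by case/orP: yy => /eqP ->.
  rewrite (in_line_side K _ ky ky' yy') kx0 eqxx /=.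
  by case/orP: yy => /eqP ->; rewrite ?xy1 ?xy2.
have pairs_not_full y y' : k y = inl s -> k y' = inl s -> y != y' ->
    full (line e y y') -> False.
  move=> ky ky' yy' [_ YL _].
  have /set0Pn[w] : side k s :\ y :\ y' != set0.
    rewrite -card_gt0; move: gt2.
    by rewrite (cardsD1 y) (cardsD1 y' (_ :\ _)) !inE ky ky' eqxx eq_sym yy'.
  rewrite !inE => /and3P[wy' wy /eqP kw]; have := YL w kw.
  by rewrite (in_line_side K _ ky ky' yy') kw eqxx /= (negbTE wy) (negbTE wy').
have /(fam_add (fam_pend K nu s) (fam_side_pairs k1 k2 n12 gt2)) F : forall L,
    pend_like e k s L -> (exists y y', [/\ k y' = inl s, y != y',
      (y == y1) || (y == y2) & L = line e y y']) -> False.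
  move=> L [_ _ _ h] [y [y' [ky' yy' yy]]]; have [ky _] := x0Y _ _ ky' yy' yy.
  exact: h.
have M : fam e full (#|side k (~~ s)| + 1).
  apply: fam_sub (fam_full xy1 kz) _ (leqnn _) => L [[z' kz' ->]|->]; first exact: full_opp.
  exact: full_sides.
have /(fam_add F M) {M}F : forall L, pend_like e k s L \/ (exists y y', [/\ k y' = inl s,
    y != y', (y == y1) || (y == y2) & L = line e y y']) -> full L -> False.
  move=> L [|[y [y' [ky' yy' yy ->]]]]; first exact: pend_like_not_full.
  by have [ky _] := x0Y _ _ ky' yy' yy; apply: pairs_not_full.
apply: leq_trans (card_lines_pend F _); first by rewrite (card_kinds s); move: mid_pos; lia.
move=> L [[[]|[y [y' [ky' yy' yy ->]]]]|[x0L _ _]] //; exists x0 => //.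
by have [] := x0Y _ _ ky' yy' yy.
Qed.

(* With two vertices on side [s], all its pendants have the same neighbourhood, so
   there are no twins and a second mid gives one further line; there are
   two lines y1z, y2z instead of the lines inside side [s]. *)
Lemma many_lines_pend_2 : #|side k s| <= 2 -> #|T| <= #|lines e|.
Proof.
move=> le2; have [y1 [y2 [n12 xy1 xy2]]] := pend_deg2 K nu kx0.
have k1 := pend_nbr K kx0 xy1; have k2 := pend_nbr K kx0 xy2.
have [z kz] := side_inhab K (~~ s).
have sideE y : k y = inl s -> (y == y1) || (y == y2).
  move=> ky; apply: contraLR le2; rewrite negb_or -ltnNge => /andP[n1 n2].
  apply/card_gt2P; exists y, y1, y2; rewrite n1 n12 eq_sym n2.
  by split; split=> //; apply/sideP.
have adj x y : k x = inr (Some s) -> k y = inl s -> e x y.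
  move=> kx /sideE yE; have [u [v [nn xu xv]]] := pend_deg2 K nu kx.
  have uE := sideE _ (pend_nbr K kx xu); have vE := sideE _ (pend_nbr K kx xv).
  move: nn xu xv yE; case/orP: uE => /eqP->; case/orP: vE => /eqP->; rewrite ?eqxx //.
    by move=> _ h h' /orP[] /eqP->.
  by move=> _ h h' /orP[] /eqP->.
have meets x b : k x = inr (Some s) -> k b = inr None -> meet e x b.
  by move=> kx kb; have [y ky by_] := mid_has K s kb; apply/meetP; exists y => //; apply: adj.
have [b [b' [kb kb' bb']]] := mid_gt1 K nu kx0.
have A : fam e (pend_like e k s) #|pend k s|.+1.
  have F1 : fam e (fun L => exists2 x, x \in pend k s & L = line e x b) #|pend k s|.
    apply: (@fam_img _ _ _ (pend k s) id (fun=> b)).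
      by move=> x /pendP kx; apply: (@kind_neq _ k); rewrite kx kb.
    move=> x x' /pendP kx /pendP kx' /= E.
    have : x \in line e x b by rewrite (line_ends K).
    rewrite E (in_line_pend_mid K _ kx' kb) kx eqxx /= => /predU1P[//|/and3P[_ _]].
    by case/negP; apply/meetP; exists y1; rewrite adj.
  have n0 : x0 != b' by apply: (@kind_neq _ k); rewrite kx0 kb'.
  have /(fam_add F1 (fam1 e n0)) F : forall L,
      (exists2 x, x \in pend k s & L = line e x b) -> L = line e x0 b' -> False.
    move=> L [x /pendP kx ->] /(mid_inj K kx kx0 kb kb') E.
    by rewrite E eqxx in bb'.
  apply: fam_sub F _ _; last by rewrite addn1.
  by move=> L [[x /pendP kx ->]|->]; apply: pend_like_mid.
(* This mid misses [y1], hence is adjacent to [y2], and so lies on exactly one of [y1z] and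
   [y2z]. *)
have [c [kc nc1 mc]] := mid_avoid K nu kx0 xy1.
have c2 : e c y2.
  have [y ky cy] := mid_has K s kc; have /orP[/eqP yE|/eqP <- //] := sideE y ky.
  by rewrite yE (negbTE nc1) in cy.
have n2z : y2 != z by apply: (@kind_neq _ k); rewrite k2 kz; case: (s).
have /(fam_add (fam_full xy1 kz) (fam1 e n2z)) M : forall L,
    (exists2 z, k z = inl (~~ s) & L = line e x0 z) \/ L = line e y1 z ->
    L = line e y2 z -> False.
  move=> L [[z' kz' ->]|->] E.
    exact: (sides_line_neq xy2 kz kz' (Logic.eq_sym E)).
  have : (c \in line e y1 z) = (c \in line e y2 z) by rewrite E.
  rewrite (in_line_sides K _ k1 kz) (in_line_sides K _ k2 kz) kc (negbTE nc1) c2.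
  by case: (e c z).
have {}M : fam e full (#|side k (~~ s)| + 1 + 1).
  apply: fam_sub M _ (leqnn _) => L [[[z' kz' ->]|->]|->]; first exact: full_opp.
    exact: full_sides.
  exact: full_sides.
apply: leq_trans (card_lines_pend (fam_add A M pend_like_not_full) _).
  by rewrite (card_kinds s); move: mid_pos le2; lia.
by move=> L [[]|[x0L _ _]] //; exists x0.
Qed.

Lemma many_lines_pend : #|T| <= #|lines e|.
Proof.
by case: (leqP #|side k s| 2) => [/many_lines_pend_2|/many_lines_pend_gt2].
Qed.
End Pendant.
End WithPendant.

(** * Graphs without pendants *)

Section WithoutPendant.
Context (T : finType) (e : rel T) (k : T -> kind) (K : parted e k).
Hypothesis nu : forall u v, u != v -> exists w, w \notin line e u v.
Let esym := edge_sym K.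

Section NoPendant.
Hypothesis np : forall u t, k u <> inr (Some t).
Let ns s : (~~ s == s) = false. Proof. by case: s. Qed.
Let sn s : (s == ~~ s) = false. Proof. by case: s. Qed.
Let neq u v c d : k u = c -> k v = d -> c != d -> u != v.
Proof. by move=> <- <-; apply: kind_neq. Qed.

Lemma card_kinds_no_pend s : #|T| = #|side k s| + #|side k (~~ s)| + #|mid k|.
Proof.
have p0 t : #|pend k t| = 0.
  by apply: eq_card0 => x; rewrite inE; apply/eqP/np.
by rewrite (card_kinds k s) !p0 !addn0.
Qed.

(** On side [s], the line [y0i] has only [y0] and [i], and [bi] for [i] nonadjacent to [b] has only
    [i]. As [b] is not adjacent to [y0], these traces determine [i]. *)
Lemma fam_across s b y0 : k b = inr None -> k y0 = inl s -> ~~ e b y0 ->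
  fam e (fun L => exists2 i, k i = inl s & L = if e b i then line e y0 i else line e b i)
    #|side k s|.
Proof.
move=> kb k0 n0; pose f i := if e b i then y0 else b.
have fE i : line e (f i) i = if e b i then line e y0 i else line e b i.
  by rewrite /f; case: ifP.
have fN i : k i = inl s -> f i != i.
  move=> ki; rewrite /f; case: ifP => [bi|_]; last exact: neq kb ki _.
  by apply: contraNneq n0 => ->.
apply: (@fam_sub _ _ _ _ #|side k s|); first apply: (@fam_img _ _ _ (side k s) f id).
- by move=> i /sideP; apply: fN.
- move=> i j /sideP ki /sideP kj /=; rewrite !fE.
  have main u v : k u = inl s -> k v = inl s ->
     u \in (if e b v then line e y0 v else line e b v) -> (e b u || ~~ e b v) -> u = v.
    move=> ku kv; case: ifP => bv; last first.
      by rewrite (in_line_mid_side K _ kb kv) ku bv eqxx => /eqP.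
    have yv : y0 != v by apply: contraNneq n0 => ->.
    rewrite (in_line_side K _ k0 kv yv) ku eqxx orbF /=.
    by case/orP => /eqP // -> h; rewrite h in n0.
  have self u : u \in (if e b u then line e y0 u else line e b u).
    by case: ifP; rewrite (line_ends K).
  move=> E; case: (boolP (e b i || ~~ e b j)) => h.
    by apply: main h; rewrite // -E.
  apply/Logic.eq_sym/main => //; first by rewrite E.
  by move: h; case: (e b i) (e b j) => [] [].
- by move=> L [i /sideP ki ->]; exists i; rewrite ?fE.
- by [].
Qed.

(** * Lines through a fixed mid *)

Section Centre.
Context (b0 : T).
Hypothesis kb0 : k b0 = inr None.
Let BB (L : {set T}) := exists b', [/\ k b' = inr None, b0 != b' & L = line e b0 b'].

(** If [v] is on [b0b] without being adjacent to [b0], then [b0] and [b] do not meet and [b0b]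
    contains all neighbours of [b0]; but [b0v] has only [v] on side [s]. *)
Lemma mid_neq_across s v L : k v = inl s -> ~~ e b0 v -> BB L -> L <> line e b0 v.
Proof.
move=> kv nv [b [kb nb ->]] E.
have vE w := in_line_mid_side K w kb0 kv.
have bE w := in_line_mid K w kb0 kb nb.
have : v \in line e b0 b by rewrite E (line_ends K).
rewrite bE kv [e v b0]esym (negbTE nv); case: (boolP (meet e b0 b)) => //= m bv.
have [y ky by_] := mid_has K s kb0.
have : y \in line e b0 b by rewrite bE ky (negbTE m) esym by_.
by rewrite E vE ky (negbTE nv) eqxx => /eqP yv; rewrite -yv by_ in nv.
Qed.

Lemma mid_neq_fam_across s y0 L : k y0 = inl s -> ~~ e b0 y0 -> BB L ->
  (exists2 i, k i = inl s & L = if e b0 i then line e y0 i else line e b0 i) -> False.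
Proof.
move=> k0 n0 BL [i ki]; case: ifP => bi; last by apply: (mid_neq_across ki) BL; rewrite bi.
have yi : y0 != i by apply: contraNneq n0 => ->.
case: BL => [b [_ _ ->]] E; have : b0 \in line e b0 b by rewrite (line_ends K).
by rewrite E (in_line_side K _ k0 ki yi) kb0 (negbTE n0).
Qed.

(** * A mid complete to one side but not to the other *)

Section Half.
Context (s : bool) (z0 : T).
Hypothesis (full0 : forall y, k y = inl s -> e b0 y).
Hypothesis (kz0 : k z0 = inl (~~ s)) (nz0 : ~~ e b0 z0).
Let E (L : {set T}) := [/\ b0 \in L, forall z, k z = inl (~~ s) -> z \in L
  & exists2 y, k y = inl s & y \in L].

Let Eside y y' : k y = inl s -> k y' = inl s -> y != y' -> E (line e y y').
Proof.
move=> ky ky' yy'; have lE w := in_line_side K w ky ky' yy'; split.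
- by rewrite lE kb0 !full0.
- by move=> z kz; rewrite lE kz ns.
- by exists y; rewrite ?(line_ends K).
Qed.

Let Eedge y : k y = inl s -> E (line e y z0).
Proof.
move=> ky; have lE w := in_line_sides K w ky kz0; split.
- by rewrite lE kb0 full0 // (negbTE nz0).
- by move=> z kz; rewrite lE kz.
- by exists y; rewrite ?(line_ends K).
Qed.

Let yz0 y : k y = inl s -> y != z0.
Proof. by move=> ky; apply: neq ky kz0 _; case: (s). Qed.

(** Lines inside side [s] suffice when it has at least three vertices; for smaller sides a line from
    side [s] to [z0] supplies the one lacking. *)
Let famE : fam e E #|side k s|.
Proof.
have [y1 k1] := side_inhab K s.
case: (ltnP 1 #|side k s|) => [/card_gt1P[u [v [/sideP ku /sideP kv uv]]]|le1]; last first.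
  by apply: fam_sub (fam1 e (yz0 k1)) _ le1 => L ->; apply: Eedge.
case: (ltnP 2 #|side k s|) => [gt2|le2].
  apply: fam_sub (fam_side_pairs K ku kv uv gt2) _ (leqnn _) => L [y [y' [ky' yy' yE ->]]].
  by apply: Eside => //; case/orP: yE => /eqP ->.
have sideE y : k y = inl s -> (y == u) || (y == v).
  move=> ky; apply: contraLR le2; rewrite negb_or -ltnNge => /andP[n1 n2].
  apply/card_gt2P; exists y, u, v; rewrite n1 uv eq_sym n2.
  by split; split=> //; apply/sideP.
(* This mid is off [uz0]. If it is adjacent to both [u] and [v], it is on [uv], so [uz0] differs
   from [uv]; otherwise it is adjacent to exactly one of them, hence off [uv] but on [vz0]. *)
have [b kb bE] := mid_unsplit K nu ku kz0.
suff [y ky /(fam_add (fam1 e uv) (fam1 e (yz0 ky))) F] : exists2 y, k y = inl s &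
    forall L, L = line e u v -> L = line e y z0 -> False.
  by apply: fam_sub F _ (le2 : _ <= 1 + 1) => L [->|->]; [apply: Eside|apply: Eedge].
have pE := in_line_side K b ku kv uv.
have uE := in_line_sides K b ku kz0; have vE := in_line_sides K b kv kz0.
rewrite kb in pE uE vE.
have [y ky bY] := mid_has K s kb.
have : e b u || e b v by case/orP: (sideE y ky) => /eqP <-; rewrite bY ?orbT.
case: (boolP (e b u && e b v)) => [uv'|nuv] orE.
  exists u => // L -> E'; move: pE; rewrite E' uE uv' bE.
  by case: (e b z0).
exists v => // L -> E'; move: pE; rewrite E' vE (negbTE nuv) -bE.
by move: orE nuv; case: (e b u) (e b v) => [] [].
Qed.

(** The families are [fam_across] for the opposite side, the line [b0z1] with [z1] a neighbour of
    [b0], the lines [b0b], and [famE]. The line [b0z1] is the only one avoiding side [s]. *)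
Lemma many_lines_half : #|T| <= #|lines e|.
Proof.
have [z1 kz1 bz1] := mid_has K (~~ s) kb0.
have [y ky] := side_inhab K s.
have n1 : b0 != z1 by apply: neq kb0 kz1 _.
have oneE w := in_line_mid_side K w kb0 kz1.
have yN w : k w = inl s -> w \notin line e b0 z1.
  by move=> kw; rewrite oneE kw bz1 sn esym full0.
have acE i w : k i = inl (~~ s) -> k w = inl s ->
    w \in if e b0 i then line e z0 i else line e b0 i.
  move=> ki kw; case: ifP => bi; last by rewrite (in_line_mid_side K _ kb0 ki) kw bi sn esym full0.
  have zi : z0 != i by apply: contraNneq nz0 => ->.
  by rewrite (in_line_side K _ kz0 ki zi) kw sn.
have /(fam_add (fam_across kb0 kz0 nz0) (fam1 e n1)) F : forall L,
    (exists2 i, k i = inl (~~ s) & L = if e b0 i then line e z0 i else line e b0 i) ->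
    L = line e b0 z1 -> False.
  move=> L [i ki ->] E'; have := acE i y ki ky.
  by rewrite E' (negbTE (yN y ky)).
have /(fam_add F (fam_mid K kb0)) {}F : forall L,
    (exists2 i, k i = inl (~~ s) & L = if e b0 i then line e z0 i else line e b0 i) \/
    L = line e b0 z1 -> BB L -> False.
  move=> L [h|->] BL; first exact: (mid_neq_fam_across kz0 nz0 BL h).
  case: BL => b [kb nb E']; have [w kw bw] := mid_has K s kb.
  case/negP: (yN w kw); rewrite E' (in_line_mid K _ kb0 kb nb) kw.
  by rewrite (esym w b0) full0 // (esym w b) bw; case: ifP.
have /(fam_add F famE) {}F : forall L,
    ((exists2 i, k i = inl (~~ s) & L = if e b0 i then line e z0 i else line e b0 i) \/
    L = line e b0 z1) \/ BB L -> E L -> False.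
  move=> L [[[i ki ->]|->]|[b [kb nb ->]]] [bL ZL _].
  - move: bL (ZL z1 kz1); case: ifP => bi.
      have zi : z0 != i by apply: contraNneq nz0 => ->.
      by rewrite (in_line_side K _ kz0 ki zi) kb0 (negbTE nz0).
    rewrite (in_line_mid_side K z1 kb0 ki) kz1 bi eqxx => _ /eqP z1i.
    by rewrite -z1i bz1 in bi.
  - by move: (ZL z0 kz0); rewrite oneE kz0 bz1 eqxx esym (negbTE nz0).
  - move: (ZL z0 kz0); rewrite (in_line_mid K _ kb0 kb nb) kz0 (esym z0 b0) (negbTE nz0).
    have [w kw bw] := mid_has K s kb.
    suff -> : meet e b0 b by [].
    by apply/meetP; exists w => //; apply: full0.
have m1 : 0 < #|mid k| by apply/card_gt0P; exists b0; apply/midP.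
apply: leq_trans (fam_card F); rewrite (card_kinds_no_pend s); move: m1; lia.
Qed.
End Half.

(** * A mid with a non-neighbour on each side *)

Section Deficient.
Context (s : bool) (y0 z0 : T).
Hypothesis (ky0 : k y0 = inl s) (ny0 : ~~ e b0 y0).
Hypothesis (kz0 : k z0 = inl (~~ s)) (nz0 : ~~ e b0 z0).
Let yE w := in_line_mid_side K w kb0 ky0.
Let zE w := in_line_mid_side K w kb0 kz0.

(** The lines inside side [s], the line [b0y0], [fam_across] for the opposite side and the lines
    [b0b] add up to [#|T|]. A third vertex on side [s] separates the first family from the lines
    [z0i], which contain that whole side. *)
Lemma many_lines_deficient : 2 < #|side k s| -> #|T| <= #|lines e|.
Proof.
move=> gt2.
have [y1 k1 b1] := mid_has K s kb0; have [z1 kz1 bz1] := mid_has K (~~ s) kb0.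
have n01 : y0 != y1 by apply: contraNneq ny0 => ->.
have nb0 : b0 != y0 by apply: neq kb0 ky0 _.
pose YP (L : {set T}) := exists y y', [/\ k y = inl s, k y' = inl s, y != y' & L = line e y y'].
have F0 : fam e YP #|side k s|.
  apply: fam_sub (fam_side_pairs K ky0 k1 n01 gt2) _ (leqnn _) => L [y [y' [ky' yy' yE' ->]]].
  by exists y, y'; split=> //; case/orP: yE' => /eqP ->.
pose ZL L := exists2 i, k i = inl (~~ s) & L = if e b0 i then line e z0 i else line e b0 i.
have /(fam_add F0 (fam1 e nb0)) {F0}F : forall L, YP L -> L = line e b0 y0 -> False.
  move=> L [y [y' [ky ky' yy' ->]]] E.
  have h w : k w = inl s -> w \in line e y y' -> w = y0.
    by move=> kw; rewrite E yE kw (negbTE ny0) eqxx => /eqP.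
  have [yl y'l] := line_ends K y y'.
  by rewrite (h y ky yl) (h y' ky' y'l) eqxx in yy'.
have /(fam_add F (fam_across kb0 kz0 nz0)) {}F : forall L,
    YP L \/ L = line e b0 y0 -> ZL L -> False.
  move=> L [[y [y' [ky ky' yy' ->]]]|->] [i ki].
    have lE w := in_line_side K w ky ky' yy'.
    case: ifP => bi E.
      have /set0Pn[w] : side k s :\ y :\ y' != set0.
        rewrite -card_gt0; move: gt2.
        by rewrite (cardsD1 y) (cardsD1 y' (_ :\ _)) !inE ky ky' eqxx eq_sym yy'.
      rewrite !inE => /and3P[wy' wy /eqP kw].
      have zi : z0 != i by apply: contraNneq nz0 => ->.
      have : w \in line e y y' by rewrite E (in_line_side K _ kz0 ki zi) kw sn.
      by rewrite lE kw eqxx (negbTE wy) (negbTE wy').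
    have : z1 \in line e y y' by rewrite lE kz1 ns.
    rewrite E (in_line_mid_side K _ kb0 ki) kz1 bi eqxx => /eqP zi.
    by rewrite -zi bz1 in bi.
  case: ifP => bi E.
    have zi : z0 != i by apply: contraNneq nz0 => ->.
    have : y1 \in line e b0 y0 by rewrite E (in_line_side K _ kz0 ki zi) k1 sn.
    by rewrite yE k1 (negbTE ny0) eqxx eq_sym (negbTE n01).
  have : y0 \in line e b0 y0 by rewrite (line_ends K).
  by rewrite E (in_line_mid_side K _ kb0 ki) ky0 bi sn esym (negbTE ny0).
have /(fam_add F (fam_mid K kb0)) {}F : forall L,
    (YP L \/ L = line e b0 y0) \/ ZL L -> BB L -> False.
  move=> L [[[y [y' [ky ky' yy' EL]]]|EL]|ZLL] BL.
  - case: BL => b [kb nb E]; have lE w := in_line_side K w ky ky' yy'.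
    have : b0 \in L by rewrite E (line_ends K).
    have : b \in L by rewrite E (line_ends K).
    rewrite EL !lE kb kb0 => /andP[by_ _] /andP[b0y _].
    have m : meet e b0 b by apply/meetP; exists y.
    have : z0 \in L by rewrite EL lE kz0 ns.
    by rewrite E (in_line_mid K _ kb0 kb nb) kz0 m esym (negbTE nz0).
  - exact: mid_neq_across ky0 ny0 BL EL.
  - exact: mid_neq_fam_across kz0 nz0 BL ZLL.
have m1 : 0 < #|mid k| by apply/card_gt0P; exists b0; apply/midP.
apply: leq_trans (fam_card F); rewrite (card_kinds_no_pend s); move: m1; lia.
Qed.

(* The four lines from [b0] to a side vertex provide at least three, and among the
   lines yy0, zz0 and yz, which avoid [b0], at least two differ. *)
Lemma many_lines_sides_le2 : #|side k s| <= 2 -> #|side k (~~ s)| <= 2 -> #|T| <= #|lines e|.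
Proof.
move=> leY leZ.
have arith a b m : a <= 2 -> b <= 2 -> 0 < m -> a + b + m <= 3 + 2 + m.-1 by lia.
have [y ky by_] := mid_has K s kb0; have [z kz bz] := mid_has K (~~ s) kb0.
have ny : y != y0 by apply: contraNneq ny0 => <-.
have nz : z != z0 by apply: contraNneq nz0 => <-.
have only t u v : #|side k t| <= 2 -> k u = inl t -> k v = inl t -> u != v ->
    forall w, k w = inl t -> (w == u) || (w == v).
  move=> le2 ku kv uv w kw; apply: contraLR le2; rewrite negb_or -ltnNge => /andP[n1 n2].
  apply/card_gt2P; exists w, u, v; rewrite n1 uv eq_sym n2.
  by split; split=> //; apply/sideP.
have Yonly := only s _ _ leY ky ky0 ny; have Zonly := only (~~ s) _ _ leZ kz kz0 nz.
have lyE w := in_line_mid_side K w kb0 ky; have lzE w := in_line_mid_side K w kb0 kz.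
have yzE w := in_line_sides K w ky kz.
have ypE w := in_line_side K w ky ky0 ny; have zpE w := in_line_side K w kz kz0 nz.
(* Each line from [b0] to a side vertex has trace [{y0, z}] ([V1]) or [{y, z0}] ([V2]) on the
   sides. *)
pose V1 (L : {set T}) := [&& b0 \in L, y0 \in L, z \in L, y \notin L & z0 \notin L].
pose V2 (L : {set T}) := [&& b0 \in L, y \in L, z0 \in L, y0 \notin L & z \notin L].
pose V L := V1 L || V2 L.
pose ends := line_ends K.
have Vy0 : V1 (line e b0 y0).
  by rewrite /V1 !ends !yE kz ky kz0 (negbTE ny0) eqxx ns !(esym _ b0) bz (negbTE nz0) (negbTE ny).
have Vz0 : V2 (line e b0 z0).
  by rewrite /V2 !ends !zE kz ky ky0 (negbTE nz0) eqxx sn !(esym _ b0) by_ (negbTE ny0) (negbTE nz).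
have Vz : V1 (line e b0 z).
  by rewrite /V1 !ends !lzE ky ky0 kz0 bz sn eqxx !(esym _ b0) by_ (negbTE ny0) (negbTE nz0).
have Vy : V2 (line e b0 y).
  by rewrite /V2 !ends !lyE ky0 kz kz0 by_ ns eqxx !(esym _ b0) bz (negbTE ny0) (negbTE nz0).
have V12 L L' : V1 L -> V2 L' -> L <> L'.
  by move=> /and5P[_ _ zL _ _] /and5P[_ _ _ _ zL'] E; rewrite E (negbTE zL') in zL.
(* A mid missed by [yz0]; its adjacencies select the third line through [b0] and separate two lines
   avoiding [b0]. *)
have [c kc cE] := mid_unsplit K nu ky kz0.
have [cy cz] : (e c y || e c y0) /\ (e c z || e c z0).
  have [u ku cu] := mid_has K s kc; have [v kv cv] := mid_has K (~~ s) kc.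
  by split; [case/orP: (Yonly u ku) cu|case/orP: (Zonly v kv) cv] => /eqP -> ->; rewrite ?orbT.
have n0 v t : k v = inl t -> b0 != v by move=> kv; apply: neq kb0 kv _.
have FV : fam e V 3.
  have /(fam_add (fam1 e (n0 _ _ ky0)) (fam1 e (n0 _ _ kz0))) F : forall L,
      L = line e b0 y0 -> L = line e b0 z0 -> False.
    by move=> L E E'; apply: V12 Vy0 Vz0 _; rewrite -E.
  (* If [c] is adjacent to [y], it lies on [b0y] but, meeting [b0] at [y], not on [b0z0]. Otherwise
     [c] is adjacent to [z], which likewise separates [b0z] from [b0y0]. *)
  case: (boolP (e c y)) => [ecy|nfy].
    have /(fam_add F (fam1 e (n0 _ _ ky))) {}F : forall L,
        L = line e b0 y0 \/ L = line e b0 z0 -> L = line e b0 y -> False.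
      move=> L [->|->]; first exact: V12 Vy0 Vy.
      have cb : c == b0 = false by apply: contraNF nz0 => /eqP <-; rewrite -cE.
      apply/nesym/(@line_neq _ _ _ c); first by rewrite lyE kc by_ ecy orbT.
      rewrite zE kc (negbTE nz0) cb /= negb_and negbK; apply/orP; right.
      by apply/meetP; exists y.
    apply: fam_sub F _ (leqnn 3) => L [[->|->]|->]; by rewrite /V ?Vy0 ?Vz0 ?Vy ?orbT.
  have ecz : e c z by move: cz; rewrite -cE (negbTE nfy) orbF.
  have /(fam_add F (fam1 e (n0 _ _ kz))) {}F : forall L,
      L = line e b0 y0 \/ L = line e b0 z0 -> L = line e b0 z -> False.
    move=> L [->|-> E]; last by apply: V12 Vz Vz0 _.
    have cb : c == b0 = false by apply: contraNF nfy => /eqP ->.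
    apply/nesym/(@line_neq _ _ _ c); first by rewrite lzE kc bz ecz orbT.
    rewrite yE kc (negbTE ny0) cb /= negb_and negbK; apply/orP; right.
    by apply/meetP; exists z.
  apply: fam_sub F _ (leqnn 3) => L [[->|->]|->]; by rewrite /V ?Vy0 ?Vz0 ?Vz ?orbT.
pose W (L : {set T}) := b0 \notin L.
have Wyz : W (line e y z) by rewrite /W yzE kb0 by_ bz.
have Wyp : W (line e y y0) by rewrite /W ypE kb0 (negbTE ny0) andbF.
have Wzp : W (line e z z0) by rewrite /W zpE kb0 (negbTE nz0) andbF.
have nyz : y != z by apply: neq ky kz _; case: (s).
have pair u v u' v' : u != v -> u' != v' -> W (line e u v) -> W (line e u' v') ->
    (c \in line e u v) != (c \in line e u' v') -> fam e W 2.
  move=> uv uv' Wu Wu' cc.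
  have /(fam_add (fam1 e uv) (fam1 e uv')) F : forall L,
      L = line e u v -> L = line e u' v' -> False.
    by move=> L -> E; rewrite E eqxx in cc.
  by apply: fam_sub F _ (leqnn 2) => L [->|->].
(* Depending on its adjacencies, [c] separates [yy0] from [zz0] or from [yz]. *)
have FW : fam e W 2.
  have P1 := pair _ _ _ _ ny nz Wyp Wzp; have P2 := pair _ _ _ _ ny nyz Wyp Wyz.
  move: P1 P2; rewrite ypE zpE yzE kc -cE; move: cy cz; rewrite -cE.
  by case: (e c y); case: (e c y0); case: (e c z) => //= _ _ P1 P2;
    [apply: P2|apply: P1|apply: P1|apply: P2|apply: P2].
have /(fam_add FV FW) F : forall L, V L -> W L -> False.
  by move=> L /orP[] /and5P[bL _ _ _ _] /negP.
have /(fam_add F (fam_mid K kb0)) {}F : forall L, V L \/ W L -> BB L -> False.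
  (* If [b0] and [b] meet, the line [b0b] misses [y0] and [z0]; otherwise it contains [y] and [z].
     Both contradict [V]. *)
  move=> L VW [b [kb nb E]]; have bE w := in_line_mid K w kb0 kb nb.
  case: VW => [VL|]; last by rewrite E /W ends.
  have yL : y \in L = if meet e b0 b then e y b else true.
    by rewrite E bE ky !(esym y) by_ /=; case: ifP.
  have zL : z \in L = if meet e b0 b then e z b else true.
    by rewrite E bE kz !(esym z) bz /=; case: ifP.
  have y0L : meet e b0 b -> y0 \notin L by move=> m; rewrite E bE ky0 m esym (negbTE ny0).
  have z0L : meet e b0 b -> z0 \notin L by move=> m; rewrite E bE kz0 m esym (negbTE nz0).
  case: (boolP (meet e b0 b)) yL zL y0L z0L VL => [m _ _ /(_ isT) h1 /(_ isT) h2|_ h1 h2 _ _];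
    by rewrite /V /V1 /V2 ?h1 ?h2 ?(negbTE h1) ?(negbTE h2) ?andbF.
have m1 : 0 < #|mid k| by apply/card_gt0P; exists b0; apply/midP.
by apply: leq_trans (fam_card F); rewrite (card_kinds_no_pend s); apply: arith.
Qed.

End Deficient.
End Centre.

Lemma fam_side_star s y0 : k y0 = inl s ->
  fam e (fun L => exists y, [/\ k y = inl s, y0 != y & L = line e y0 y]) #|side k s|.-1.
Proof.
move=> k0; have y0s : y0 \in side k s by apply/sideP.
apply: (@fam_sub _ _ _ _ #|side k s :\ y0|);
  first apply: (@fam_img _ _ _ (side k s :\ y0) (fun=> y0) id).
- by move=> i; rewrite !inE eq_sym => /andP[].
- move=> i j; rewrite !inE => /andP[i0 /eqP ki] /andP[j0 /eqP kj] /= E.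
  have j0' : y0 != j by rewrite eq_sym.
  have : i \in line e y0 i by rewrite (line_ends K).
  by rewrite E (in_line_side K _ k0 kj j0') ki eqxx (negbTE i0) => /eqP.
- move=> L [i]; rewrite !inE => /andP[i0 /eqP ki] ->; exists i.
  by rewrite eq_sym.
- by rewrite (cardsD1 y0 (side k s)) y0s.
Qed.

(** * All mids adjacent to all side vertices *)

Section Complete.
Hypothesis adj : forall b y t, k b = inr None -> k y = inl t -> e b y.

Lemma line_not_all (L : {set T}) u v : u != v -> L = line e u v ->
  (forall b, k b = inr None -> b \in L) -> (forall w t, k w = inl t -> w \in L) -> False.
Proof.
move=> /nu[w wL] E BL SL; move: wL; rewrite -E.
by case kw: (k w) => [t|[t|]]; [rewrite (SL w t)|case: (np kw)|rewrite BL].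
Qed.

(** The stars at [y0], [z0] and [b0] inside their own kinds each lose one line; a line in two of
    these stars would be universal. The three lines generated by [b0], [y0], [z0] restore the
    count. *)
Lemma many_lines_complete : #|T| <= #|lines e|.
Proof.
have [y0 ky0] := side_inhab K true; have [z0 kz0] := side_inhab K false.
have [b0 kb0 _] := mid_unsplit K nu ky0 kz0.
have n1 : b0 != y0 by apply: neq kb0 ky0 _.
have n2 : b0 != z0 by apply: neq kb0 kz0 _.
have n3 : y0 != z0 by apply: neq ky0 kz0 _.
have ends := line_ends K.
have by0 : z0 \notin line e b0 y0.
  by rewrite (in_line_mid_side K _ kb0 ky0) kz0 !(esym _ b0) !(adj kb0 ky0, adj kb0 kz0).
have bz0 : y0 \notin line e b0 z0.
  by rewrite (in_line_mid_side K _ kb0 kz0) ky0 !(esym _ b0) !(adj kb0 ky0, adj kb0 kz0).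
have yz0 : b0 \notin line e y0 z0.
  by rewrite (in_line_sides K (s := true) _ ky0 kz0) kb0 !(adj kb0 ky0, adj kb0 kz0).
(* Each line of a star contains all of [b0], [y0], [z0], while a line generated by two of these
   misses the third. *)
pose R (L : {set T}) := ~~ [&& b0 \in L, y0 \in L & z0 \in L].
have FR : fam e R (1 + 1 + 1).
  have /(fam_add (fam1 e n1) (fam1 e n2)) F : forall L,
      L = line e b0 y0 -> L = line e b0 z0 -> False.
    by move=> L -> E; case/negP: bz0; rewrite -E ends.
  have /(fam_add F (fam1 e n3)) {}F : forall L,
      L = line e b0 y0 \/ L = line e b0 z0 -> L = line e y0 z0 -> False.
    by move=> L [] -> E; case/negP: yz0; rewrite -E ends.
  apply: fam_sub F _ (leqnn _) => L [[]|] ->; rewrite /R.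
  - by rewrite (negbTE by0) !andbF.
  - by rewrite (negbTE bz0) andbF.
  - by rewrite (negbTE yz0).
pose BB (L : {set T}) := exists b', [/\ k b' = inr None, b0 != b' & L = line e b0 b'].
pose SS s v (L : {set T}) := exists y, [/\ k y = inl s, v != y & L = line e v y].
have BBs L : BB L -> forall w t, k w = inl t -> w \in L.
  move=> [b [kb nb ->]] w t kw; rewrite (in_line_mid K _ kb0 kb nb) kw.
  by rewrite !(esym w) (adj kb0 kw) (adj kb kw); case: ifP.
have SSb s v L : k v = inl s -> SS s v L -> forall b, k b = inr None -> b \in L.
  move=> kv [y [ky vy ->]] b kb.
  by rewrite (in_line_side K _ kv ky vy) kb (adj kb kv) (adj kb ky).
have SSs s v L : k v = inl s -> SS s v L -> forall w, k w = inl (~~ s) -> w \in L.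
  by move=> kv [y [ky vy ->]] w kw; rewrite (in_line_side K _ kv ky vy) kw ns.
have /(fam_add (fam_side_star ky0) (fam_side_star kz0)) F : forall L,
    SS true y0 L -> SS false z0 L -> False.
  move=> L Y Z; case: (Y) => y [_ /line_not_all h /h]; apply.
    exact: SSb Y.
  by move=> w [] kw; [apply: SSs kz0 Z w kw|apply: SSs ky0 Y w kw].
have /(fam_add F (fam_mid K kb0)) {}F : forall L,
    SS true y0 L \/ SS false z0 L -> BB L -> False.
  move=> L S B; case: (B) => b [_ /line_not_all h /h]; apply; last exact: BBs.
  by case: S; apply: SSb.
have /(fam_add F FR) {}F : forall L,
    (SS true y0 L \/ SS false z0 L) \/ BB L -> R L -> False.
  move=> L S; apply/negP; rewrite negbK; case: S => [[]|] S; apply/and3P; split.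
  - exact: SSb S _ kb0.
  - by case: S => y [_ _ ->]; rewrite ends.
  - exact: SSs S _ kz0.
  - exact: SSb S _ kb0.
  - exact: SSs S _ ky0.
  - by case: S => y [_ _ ->]; rewrite ends.
  - by case: S => y [_ _ ->]; rewrite ends.
  - exact: BBs S _ _ ky0.
  - exact: BBs S _ _ kz0.
apply: leq_trans (fam_card F); rewrite (card_kinds_no_pend true).
have : 0 < #|mid k| by apply/card_gt0P; exists b0; apply/midP.
have : 0 < #|side k true| by apply/card_gt0P; exists y0; apply/sideP.
have : 0 < #|side k (~~ true)| by apply/card_gt0P; exists z0; apply/sideP.
have arith a b m : 0 < b -> 0 < a -> 0 < m -> a + b + m <= a.-1 + b.-1 + m.-1 + (1 + 1 + 1) by lia.
exact: arith.
Qed.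
End Complete.

Lemma many_lines_no_pend : #|T| <= #|lines e|.
Proof.
pose full b s := [forall y in side k s, e b y].
have fullP b s : k b = inr None -> ~~ full b s -> exists2 y, k y = inl s & ~~ e b y.
  by move=> kb /forall_inPn[y /sideP ky nby]; exists y.
have half b s : k b = inr None -> full b s -> ~~ full b (~~ s) -> #|T| <= #|lines e|.
  move=> kb /forall_inP f /(fullP _ _ kb)[z kz nz].
  by apply: (many_lines_half kb (z0 := z) (s := s)) => // y ky; apply/f/sideP.
case: (boolP [exists b in mid k, ~~ (full b true && full b false)]); last first.
  move/exists_inPn => h; apply: many_lines_complete => b y t kb ky.
  have := h b; rewrite negbK => /(_ (introT (midP _ _) kb)) /andP[ft ff].
  have f : full b t by case: (t).
  by apply: (forall_inP f); apply/sideP.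
case/exists_inP => b /midP kb; rewrite negb_and.
case: (boolP (full b true)) => [ft /= ff|nt _]; first exact: half ft ff.
case: (boolP (full b false)) => [ff|nf]; first exact: half ff nt.
have [y ky ny] := fullP _ _ kb nt; have [z kz nz] := fullP _ _ kb nf.
case: (leqP #|side k true| 2) => [leY|]; last exact: (many_lines_deficient kb ky ny (z0 := z)).
case: (leqP #|side k false| 2) => [leZ|]; last exact: (many_lines_deficient kb kz nz (z0 := y)).
exact: (many_lines_sides_le2 kb ky ny (z0 := z)).
Qed.
End NoPendant.
End WithoutPendant.

(** * The theorem: empty sides, then the cases with and without pendants *)

Theorem theorem1 (T : finType) (e : rel T) :
  2 <= #|T| -> simple_graph e -> connected_graph e -> bisplit e ->
  deBruijn_Erdos e.
Proof.
move=> T2 [esym eirr] econ [X [Y [Z [XY [XZ [YZ [XYZ [sX [sY [sZ eYZ]]]]]]]]]].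
have stE A u v : stable e A -> u \in A -> v \in A -> e u v = false.
  by move=> /forall_inP h uA vA; apply/negbTE/(forall_inP (h u uA)).
have inXYZ u : [|| u \in X, u \in Y | u \in Z].
  by have := in_setT u; rewrite -XYZ !inE orbA.
have [x _] : exists x : T, x \in T by apply/card_gt0P; apply: ltnW.
have [y xy] := has_edge econ x T2.
have nxy : x != y by apply: contraTneq xy => ->; rewrite eirr.
(* An empty [Y] or [Z] leaves a bipartite graph with [X] as one colour class. *)
have bip (c : {set T}) : (forall u v, u \in c -> v \in c -> e u v = false) ->
    (forall u v, u \notin c -> v \notin c -> e u v = false) -> deBruijn_Erdos e.
  move=> c1 c2; left; exists x, y; split=> //.
  apply: (bipartite_universal esym econ (c := fun u => u \in c)) => // u v uv.
  case: (boolP (u \in c)) (boolP (v \in c)) => [uc|uc] [vc|vc] //.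
    by rewrite (c1 u v) in uv.
  by rewrite (c2 u v) in uv.
have [Y0|Y0] := eqVneq Y set0.
  apply: (bip X) => u v; first exact: stE.
  have := inXYZ u; have := inXYZ v; rewrite Y0 !inE => + + /negbTE uX /negbTE vX.
  by rewrite uX vX /= => vZ uZ; apply: stE sZ _ _.
have [Z0|Z0] := eqVneq Z set0.
  apply: (bip X) => u v; first exact: stE.
  have := inXYZ u; have := inXYZ v; rewrite Z0 !inE !orbF => + + /negbTE uX /negbTE vX.
  by rewrite uX vX /= => vY uY; apply: stE sY _ _.
have [k K] := bisplit_parted esym eirr econ T2 XY XZ YZ XYZ sX sY sZ eYZ Y0 Z0.
case: (boolP [exists a, exists b, (a != b) && (line e a b == setT)]).
  by case/existsP => a /existsP[b /andP[ab /eqP E]]; left; exists a, b.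
move/existsPn => nu'; right.
have nu u v : u != v -> exists w, w \notin line e u v.
  move=> uv; have /existsPn/(_ v) := nu' u; rewrite uv /= => /negP nT.
  apply/existsP; rewrite -negb_forall; apply/negP => /forallP h; case: nT.
  by apply/eqP/setP => w; rewrite h inE.
case: (pickP (fun x : T => k x \in [:: inr (Some true); inr (Some false)])) => [a|np].
  by rewrite !inE => /orP[] /eqP ka; exact: (many_lines_pend K nu ka).
apply: (many_lines_no_pend K nu) => u t ku.
by have := np u; rewrite ku !inE; case: (t).
Qed.
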